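(* There exists an absolute constant $n_0$ such that the following holds. Let $n,s$ be positive integers with $n\ge 5s$ and $n\ge n_0$, and let $H$ be an $n$-vertex $4$-uniform hypergraph with matching number $\nu(H)\le s$. Then $e(H)\le \binom{n}{4}-\binom{n-s}{4}$.
   Context: A $4$-uniform hypergraph ($4$-graph) $H$ is a vertex set $V(H)$ with an edge set $E(H)\subseteq\binom{V(H)}{4}$; $e(H)=|E(H)|$. A matching is a set of pairwise disjoint edges, and $\nu(H)$ is the maximum size of a matching in $H$. *)

(* Defs.v *)
From mathcomp Require Import all_boot.

Set Implicit Arguments.
Unset Strict Implicit.
Unset Printing Implicit Defensive.

(* A hypergraph on the vertex set T is given by its edge set H : {set {set T}}. *)

Definition uniform (T : finType) (k : nat) (H : {set {set T}}) : bool :=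
  [forall e in H, #|e| == k].

Definition matching (T : finType) (H M : {set {set T}}) : bool :=
  (M \subset H) &&
  [forall e in M, forall f in M, (e != f) ==> [disjoint e & f]].

Definition matching_number (T : finType) (H : {set {set T}}) : nat :=
  \max_(M : {set {set T}} | matching H M) #|M|.

(* Main.v *)
(** Compressions reduce the statement to shifted families on [{0, ..., n-1}].
    Let [S] be the first [s] vertices and [N = n - s].  Edges meeting [S] in at
    least two vertices cost nothing, so it suffices that the 4-sets meeting [S]
    in exactly one vertex and missing from [H] outnumber the edges disjoint
    from [S].

    If the link of a vertex of index about [2s/3] is so dense that triples for
    the first [2s/3] vertices can be chosen greedily after any choice for the
    remaining ones, then the links of the remaining vertices are
    cross-dependent.  Frankl's averaging argument over random disjoint triples,
    together with the local LYM inequality for the edges missing the first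
    [s + 1] vertices, gives the exact bound.  The same argument without greedy
    step covers [n >= 13s + 13].

    Otherwise of order [n^4] sets are missing.  Linear programming duality on
    long blocks of consecutive vertices gives a nonincreasing fractional cover
    [om] of [H] of total weight [s + o(n)].  Let [X_1, ..., X_4] be the weights
    of independent random vertices outside [S], [1 - U] the weight of a random
    vertex of [S], and [u] the maximum of [U], so that [X_i <= 1 - u].  The
    claim becomes, up to lower order terms,
      [P(X_1 + ... + X_4 >= 1) <= 4 (E X_1 / E U) P(X_1 + X_2 + X_3 < U)]
    whenever [4 E X_1 <= E U]; it follows from size-biased forms of Markov's
    inequality with a constant factor to spare. *)
Require Import Defs.
From mathcomp Require Import all_boot all_order all_algebra all_fingroup.
From mathcomp Require Import zify ring lra.

Set Implicit Arguments.
Unset Strict Implicit.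
Unset Printing Implicit Defensive.

(** * Shifting *)

Lemma matchingP (T : finType) (H M : {set {set T}}) :
  reflect (M \subset H /\ {in M &, forall e f : {set T}, e != f -> [disjoint e & f]}) (matching H M).
Proof.
apply: (iffP andP) => -[sMH dM]; split=> //.
  move=> e f eM fM nef; move/forall_inP: dM => /(_ e eM)/forall_inP/(_ f fM).
  by rewrite nef.
by apply/forall_inP => e eM; apply/forall_inP => f fM; apply/implyP; exact: dM.
Qed.

Lemma matching_numberP (T : finType) (H : {set {set T}}) (s : nat) :
  reflect (forall M, matching H M -> #|M| <= s) (matching_number H <= s).
Proof. exact: bigmax_leqP. Qed.

Lemma matching_inj_imset (T T' : finType) (f : T -> T') (H M : {set {set T}})
    (H' : {set {set T'}}) :
  injective f -> matching H M -> {in M, forall e : {set T}, f @: e \in H'} ->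
  matching H' [set f @: e | e : {set T} in M] /\ #|[set f @: e | e : {set T} in M]| = #|M|.
Proof.
move=> fI /matchingP[sMH dM] fM; split; last by apply: card_imset; exact: imset_inj.
apply/matchingP; split.
  by apply/subsetP => _ /imsetP[e eM ->]; exact: fM.
move=> _ _ /imsetP[e eM ->] /imsetP[g gM ->] neq.
rewrite -setI_eq0 -imsetI; last by move=> x y _ _; exact: fI.
rewrite imset_eq0 setI_eq0; apply: dM => //.
by apply: contraNneq neq => ->.
Qed.

Lemma transport_hypergraph (T T' : finType) (f : T -> T') (H : {set {set T}}) k s :
  bijective f -> uniform k H -> matching_number H <= s ->
  exists H' : {set {set T'}}, [/\ uniform k H', matching_number H' <= s & #|H'| = #|H|].
Proof.
case=> g fK gK /forall_inP uH nuH; exists [set f @: e | e : {set T} in H].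
have fI := can_inj fK; have gI := can_inj gK; split.
- by apply/forall_inP => _ /imsetP[e eH ->]; rewrite card_imset // uH.
- apply/matching_numberP => M mM; have [|mM' <-] := matching_inj_imset (H' := H) gI mM.
    move=> e eM; have [/subsetP/(_ e eM)/imsetP[e' e'H ->] _] := matchingP _ _ mM.
    by rewrite -imset_comp (eq_imset _ (g := id)) ?imset_id.
  exact: (matching_numberP _ _ nuH).
- by apply: card_imset; exact: imset_inj.
Qed.

Section Shift.
Variable n : nat.
Implicit Types (H M : {set {set 'I_n}}) (e f : {set 'I_n}) (i j : 'I_n).

(** Taking the image under a transposition makes this an involution that preserves cardinality for
    every [e]; it replaces [j] by [i] when [j] lies in [e] and [i] does not. *)
Definition swap i j e := [set tperm i j v | v in e].

Definition shifted H : Prop :=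
  forall e i j, e \in H -> i < j -> j \in e -> i \notin e -> swap i j e \in H.

Lemma swapK i j : involutive (swap i j).
Proof.
move=> e; rewrite /swap -imset_comp (eq_imset _ (g := id)) ?imset_id // => v /=.
exact: tpermK.
Qed.

Lemma mem_swap i j e v : (v \in swap i j e) = (tperm i j v \in e).
Proof. by rewrite -{1}[v](tpermK i j) mem_imset //; exact: perm_inj. Qed.

Lemma swap_id i j e : i \notin e -> j \notin e -> swap i j e = e.
Proof.
move=> ie je; apply/setP => v; rewrite mem_swap; case: tpermP => // ->.
  by rewrite (negPf ie) (negPf je).
by rewrite (negPf ie) (negPf je).
Qed.

Lemma swapE i j e : j \in e -> i \notin e -> swap i j e = i |: (e :\ j).
Proof.
move=> je ie; apply/setP => v; rewrite mem_swap !inE.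
have nij : i != j by apply: contraNneq ie => ->.
case: tpermP => [->|->|/eqP/negPf -> /eqP/negPf ->] //; rewrite ?je ?eqxx //.
by rewrite (negPf ie) eq_sym (negPf nij).
Qed.

Definition compress_edge i j H e :=
  if [&& j \in e, i \notin e & swap i j e \notin H] then swap i j e else e.

Definition compress i j H := [set compress_edge i j H e | e in H].

Lemma compress_edge_inj i j H : {in H &, injective (compress_edge i j H)}.
Proof.
move=> e f eH fH; rewrite /compress_edge.
case: ifP => [/and3P[_ _ sH]|_]; case: ifP => [/and3P[_ _ sH']|_] //.
- by move/(inv_inj (swapK i j)).
- by move=> E; move: sH; rewrite E fH.
- by move=> E; move: sH'; rewrite -E eH.
Qed.

(** An edge of the compression without [i] was not moved; if it contains [j], it stayed only because
    its exchanged copy was already present. *)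
Lemma compress_mem i j H f : f \in compress i j H -> i \notin f ->
  f \in H /\ (j \in f -> swap i j f \in H).
Proof.
case/imsetP=> e eH ->; rewrite /compress_edge; case: ifP => [/and3P[je ie _]|].
  by rewrite mem_swap tpermL je.
move=> ne ie; split=> // je; move: ne; rewrite je ie /=.
by move/negbFE.
Qed.

(* At most one edge of [M] lies outside [H], as it must contain [i]; if there is
   one, exchanging [i] and [j] in all edges of [M] gives a matching of [H]. *)
Lemma compress_matching i j H M : matching (compress i j H) M ->
  exists2 M', matching H M' & #|M'| = #|M|.
Proof.
move=> mM; have [/subsetP sM dM] := matchingP _ _ mM.
have [sMH|] := boolP (M \subset H).
  by exists M => //; apply/matchingP.
case/subsetPn => f fM fH.
have /imsetP[e eH fe] := sM f fM.
move: fe; rewrite /compress_edge; case: ifP => [/and3P[je ie _] fe|_ fe]; last first.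
  by rewrite fe eH in fH.
have if_ : i \in f by rewrite fe mem_swap tpermL.
have [|mM' cM'] := matching_inj_imset (H' := H) (@perm_inj _ (tperm i j)) mM.
  move=> m mMm; rewrite -/(swap i j m).
  have [->|nmf] := eqVneq m f; first by rewrite fe swapK.
  have im : i \notin m.
    by apply/negP => im; have /disjointFr/(_ im) := dM _ _ mMm fM nmf; rewrite if_.
  have [mH sH] := compress_mem (sM m mMm) im.
  by have [/sH //|jm] := boolP (j \in m); rewrite swap_id.
by exists [set [set tperm i j x | x in e] | e : {set 'I_n} in M].
Qed.

Lemma compress_matching_number i j H :
  matching_number (compress i j H) <= matching_number H.
Proof.
apply/matching_numberP => M /compress_matching[M' mM' <-].
exact: (matching_numberP H _ (leqnn _)).
Qed.

Lemma compress_uniform i j H k : uniform k H -> uniform k (compress i j H).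
Proof.
move=> /forall_inP uH; apply/forall_inP => _ /imsetP[e eH ->]; rewrite /compress_edge.
by case: ifP => _; rewrite ?card_imset ?uH //; exact: perm_inj.
Qed.

Definition position_sum H := \sum_(e in H) \sum_(v in e) v.

Lemma swap_sum_lt i j e : i < j -> j \in e -> i \notin e ->
  \sum_(v in swap i j e) (v : nat) < \sum_(v in e) (v : nat).
Proof.
move=> ij je ie; rewrite big_imset /=; last by move=> x y _ _; exact: perm_inj.
rewrite (bigD1 j) //= [X in _ < X](bigD1 j) //= tpermR -addSn leq_add //.
apply: leq_sum => v /andP[ve vj]; case: tpermP => // [E|->]; last exact: ltnW.
by rewrite -E ve in ie.
Qed.

Lemma compress_position_sum i j H e : i < j -> e \in H -> j \in e -> i \notin e ->
  swap i j e \notin H -> position_sum (compress i j H) < position_sum H.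
Proof.
move=> ij eH je ie sH; rewrite /position_sum big_imset /=; last exact: compress_edge_inj.
rewrite (bigD1 e) //= [X in _ < X](bigD1 e) //= -addSn leq_add //.
  by rewrite /compress_edge je ie sH; exact: swap_sum_lt.
apply: leq_sum => f _; rewrite /compress_edge; case: ifP => // /and3P[jf if_ _].
exact: ltnW (swap_sum_lt _ _ _).
Qed.

(** Each compression at a violating triple [(e, i, j)] strictly lowers [position_sum], so the
    process stops, and it can only stop at a shifted family. *)
Lemma shifted_exists H k s : uniform k H -> matching_number H <= s ->
  exists H', [/\ shifted H', uniform k H', matching_number H' <= s & #|H'| = #|H|].
Proof.
have [m] := ubnP (position_sum H); elim: m H => // m IH H Hm uH nuH.
case: (pickP [pred p : {set 'I_n} * 'I_n * 'I_n | [&& p.1.1 \in H, p.1.2 < p.2, p.2 \in p.1.1,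
   p.1.2 \notin p.1.1 & swap p.1.2 p.2 p.1.1 \notin H]]) => [[[e i] j]|none].
  case/and5P=> /= eH ij je ie sH.
  have [|||H' [sH' uH' nuH' cH']] := IH (compress i j H).
  - exact: leq_trans (compress_position_sum ij eH je ie sH) _.
  - exact: compress_uniform.
  - exact: leq_trans (compress_matching_number _ _ _) nuH.
  exists H'; split=> //; rewrite cH' card_in_imset //; exact: compress_edge_inj.
exists H; split=> // e i j eH ij je ie.
by have := none (e, i, j); rewrite /= eH ij je ie /= => /negbFE.
Qed.

End Shift.

(** * Cross-dependent families *)

Section Averaging.
Variables (T : finType) (C : {set T}) (k : nat).
Implicit Types (A B : {set T}) (G : {set {set T}}).

Definition ksubsets : {set {set T}} := [set A : {set T} | (A \subset C) && (#|A| == k)].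

Lemma card_ksubsets : #|ksubsets| = 'C(#|C|, k).
Proof. exact: cards_draws. Qed.

(** Exchanging an element of [A :\: B] for one of [B :\: A] brings [A] closer to [B], so single
    exchanges connect all [k]-subsets of [C]. *)
Lemma exchange_invariant_const (R : Type) (c : {set T} -> R) :
  (forall A x y, A \in ksubsets -> x \in A -> y \in C -> y \notin A -> c (y |: (A :\ x)) = c A) ->
  {in ksubsets &, forall A B, c A = c B}.
Proof.
move=> cE A B; have [d] := ubnP #|A :\: B|; elim: d A => // d IH A hd.
rewrite !inE => /andP[sA /eqP cA] /andP[sB /eqP cB].
have [AB|] := boolP (A \subset B).
  by congr c; apply/eqP; rewrite eqEcard AB cA cB leqnn.
case/subsetPn => x xA xB.
have /subsetPn[y yB yA] : ~~ (B \subset A).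
  apply/negP => BA; have /eqP E : B == A by rewrite eqEcard BA cA cB leqnn.
  by rewrite E xA in xB.
have yC := subsetP sB y yB.
have AK : A \in ksubsets by rewrite inE sA cA eqxx.
rewrite -(cE A x y) //; apply: IH; rewrite ?inE ?sB ?cB ?eqxx //.
- rewrite ltnS in hd; apply: leq_trans hd; apply: proper_card; apply/properP; split.
    by apply/subsetP => z; rewrite !inE; case: eqP => [->|]; rewrite ?yB //= => _ /and3P[-> _ ->].
  by exists x; rewrite !inE ?eqxx ?xA ?xB //= orbF; apply: contraNneq yA => <-.
- apply/andP; split.
    apply/subsetP => z; rewrite !inE => /predU1P[->//|/andP[_ zA]].
    exact: (subsetP sA).
  by rewrite cardsU1 !inE (negPf yA) andbF -cA [#|A|](cardsD1 x) xA.
Qed.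

Definition placements := [set p : {perm T} | perm_on C p].

(* Double counting: under a uniformly random permutation of [C] every [f i] is a
   uniformly random [k]-subset of [C]. *)
Lemma averaging (q : nat) (f : 'I_q -> {set T}) G :
  (forall i, f i \in ksubsets) -> G \subset ksubsets ->
  (\sum_(p in placements) #|[set i | [set p x | x in f i] \in G]|) * 'C(#|C|, k)
  = #|placements| * q * #|G|.
Proof.
move=> fK /subsetP GK.
pose c A := \sum_(p in placements) \sum_i ([set p x | x in f i] == A : nat).
(* Multiplying placements by the transposition of [x] and [y] permutes them and turns hits of [A]
   into hits of the exchanged set. *)
have cE : {in ksubsets &, forall A B, c A = c B}.
  apply: exchange_invariant_const => A x y; rewrite inE => /andP[sA _] xA yC yA.
  have xC := subsetP sA x xA.
  have xyC : perm_on C (tperm x y).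
    by apply: subset_trans (tperm_on x y) _; rewrite subUset !sub1set xC.
  rewrite /c (reindex_inj (mulIg (tperm x y))) /=; apply: eq_big => [p|p _].
    rewrite !inE; apply/idP/idP => h.
      rewrite -[p](mulgK (tperm x y)) tpermV; exact: perm_onM.
    exact: perm_onM.
  apply: eq_bigr => i _; congr (nat_of_bool _).
  have -> : [set (p * tperm x y)%g z | z in f i] = [set tperm x y z | z in [set p z | z in f i]].
    by rewrite -imset_comp; apply: eq_imset => z; rewrite /= permM.
  have -> : y |: (A :\ x) = [set tperm x y z | z in A].
    apply/setP => z; rewrite -[z in RHS](tpermK x y) mem_imset; last exact: perm_inj.
    rewrite !inE; case: tpermP => [->|->|/eqP/negPf -> /eqP/negPf ->] //.
      by rewrite eqxx (negPf yA) /= orbF; apply: contraNF yA => /eqP <-.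
    by rewrite eqxx xA.
  by rewrite (inj_eq (imset_inj (@perm_inj _ _))).
have sumE G' : G' \subset ksubsets -> \sum_(A in G') c A =
    \sum_(p in placements) #|[set i | [set p x | x in f i] \in G']|.
  move=> _; rewrite /c exchange_big /=; apply: eq_bigr => p _; rewrite exchange_big /=.
  rewrite -[RHS]sum1_card [RHS]big_mkcond /=; apply: eq_bigr => i _; rewrite inE.
  case: ifP => h; last by rewrite big1 // => A AG; case: eqP => // E; rewrite E AG in h.
  rewrite (bigD1 _ h) /= eqxx big1 // => A /andP[_ nA].
  by rewrite eq_sym (negPf nA).
have [->|[B BG]] := set_0Vmem G.
  rewrite cards0 muln0; apply/eqP; rewrite muln_eq0; apply/orP; left.
  by rewrite big1 // => p _; apply/eqP; rewrite cards_eq0; apply/eqP/setP => i; rewrite !inE.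
have constE G' : G' \subset ksubsets -> \sum_(A in G') c A = #|G'| * c B.
  move=> /subsetP G'K; rewrite (eq_bigr (fun _ => c B)) ?sum_nat_const // => A AG.
  by apply: cE; [exact: G'K | exact: GK].
rewrite -sumE; last exact/subsetP.
rewrite constE; last exact/subsetP.
(* The family of all [k]-subsets evaluates the constant: a placement keeps each [f i] inside [C], so
   all [q] of them are hits. *)
have := constE _ (subxx _); rewrite sumE // card_ksubsets => E.
rewrite -mulnA [c B * _]mulnC -E mulnC; congr (_ * _).
rewrite (eq_bigr (fun _ => q)) ?sum_nat_const // => p; rewrite inE => pC.
rewrite -[RHS]card_ord -cardsT; congr #|pred_of_set _|; apply/setP => i; rewrite !inE.
have := fK i; rewrite inE => /andP[sf /eqP cf].
rewrite card_imset ?cf ?eqxx ?andbT; last exact: perm_inj.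
apply/subsetP => _ /imsetP[x xf ->]; rewrite perm_closed //; exact: (subsetP sf).
Qed.

End Averaging.

Lemma card_bigcup_le (T I : finType) (P : pred I) (F : I -> {set T}) :
  #|\bigcup_(i | P i) F i| <= \sum_(i | P i) #|F i|.
Proof.
elim/big_rec2: _ => [|i m A _ IH]; first by rewrite cards0.
by rewrite cardsU (leq_trans (leq_subr _ _)) // leq_add2l.
Qed.

Lemma exists_ksubset (T : finType) (C : {set T}) k : k <= #|C| -> exists A, A \in ksubsets C k.
Proof.
by move=> kC; apply/set0Pn; rewrite -card_gt0 card_ksubsets bin_gt0.
Qed.

Section CrossDependent.
Variables (T : finType) (C : {set T}).
Implicit Types (G : nat -> {set {set T}}) (t : nat -> {set T}).

Definition rainbow G a b t : Prop :=
  (forall i, a <= i < b -> t i \in G i) /\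
  (forall i j, a <= i < b -> a <= j < b -> i != j -> [disjoint t i & t j]).

Lemma rainbow_extend G a b t A : rainbow G a.+1 b t -> A \in G a ->
  (forall i, a < i < b -> [disjoint A & t i]) ->
  exists t', rainbow G a b t'.
Proof.
move=> [tG td] AG Ad; exists (fun i => if i == a then A else t i); split.
  move=> i /andP[ai ib]; have [->//|ia] := eqVneq i a.
  by apply: tG; rewrite ib andbT ltn_neqAle eq_sym ia.
move=> i j /andP[ai ib] /andP[aj jb] ij.
have [ia|ia] := eqVneq i a; have [ja|ja] := eqVneq j a.
- by rewrite ia ja eqxx in ij.
- by apply: Ad; rewrite jb andbT ltn_neqAle eq_sym ja.
- by rewrite disjoint_sym; apply: Ad; rewrite ib andbT ltn_neqAle eq_sym ia.
- by apply: td; rewrite // ?ib ?jb andbT ltn_neqAle eq_sym ?ia ?ja.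
Qed.

(** The choice runs downwards from [b]: when index [i] is reached, the sets already chosen cover at
    most [k * (c - i.+1)] points, and [Gfree] supplies a set avoiding them. *)
Lemma rainbow_greedy G k a b c t : a <= b -> rainbow G b c t ->
  (forall i, i < c -> G i \subset ksubsets C k) ->
  (forall i (W : {set T}), a <= i < b -> #|W| <= k * (c - i.+1) ->
     exists2 A, A \in G i & [disjoint A & W]) ->
  exists t', rainbow G a c t'.
Proof.
move=> ab rt GK Gfree.
have [d] := ubnP (b - a); elim: d a ab Gfree => // d IH a ab Gfree hd.
have [ba|ab'] := leqP b a.
  have E : a = b by apply/eqP; rewrite eqn_leq ab ba.
  by exists t; rewrite E.
have [||t' rt'] := IH a.+1 ab'.
- by move=> i W /andP[ai ib]; apply: Gfree; rewrite ib ltnW.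
- by rewrite ltnS in hd; apply: leq_trans hd; rewrite ltn_sub2l.
pose W := \bigcup_(i < c | a < i) t' i.
have [||A AG AW] := Gfree a W; first by rewrite leqnn.
  apply: leq_trans (card_bigcup_le _ _) _.
  rewrite (eq_bigr (fun _ => k)); last first.
    move=> i ai; have := subsetP (GK i (ltn_ord i)) (t' i).
    rewrite inE => /(_ (rt'.1 i _)); rewrite ai ltn_ord => /(_ isT)/andP[_ /eqP].
    by [].
  rewrite sum_nat_const mulnC leq_mul2l; apply/orP; right.
  rewrite -sum1_card -(big_mkord (fun i => a < i) (fun _ => 1)).
  by rewrite -(big_nat_widenl a.+1 0 c xpredT) // sum_nat_const_nat muln1.
apply: (rainbow_extend rt' AG) => i /andP[ai ic]; apply: disjointWr AW.
exact: (bigcup_sup (Ordinal ic)).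
Qed.

Lemma disjoint_ksubsets k q : k * q <= #|C| ->
  exists t, rainbow (fun _ => ksubsets C k) 0 q t.
Proof.
move=> kq; apply: (@rainbow_greedy _ k 0 q q (fun _ => set0)) => //.
- by split=> i; [|move=> j]; case/andP=> h /(leq_ltn_trans h); rewrite ltnn.
- move=> i W /= iq hW.
  have [|A] := @exists_ksubset _ (C :\: W) k.
    rewrite cardsD leq_subRL; last first.
      apply: leq_trans kq; rewrite (leq_trans (subset_leq_card (subsetIr _ _))) //.
      by rewrite (leq_trans hW) // leq_mul2l leq_subr orbT.
    apply: leq_trans kq; rewrite (leq_trans (leq_add (subset_leq_card (subsetIr _ _)) (leqnn _))) //.
    rewrite (leq_trans (leq_add hW (leqnn _))) //.
    by rewrite -mulnSr leq_mul2l subnSK ?leq_subr ?orbT.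
  rewrite inE subsetD => /andP[/andP[AC AW] cA]; exists A => //.
  by rewrite inE AC cA.
Qed.

(** Choosing from [i = r] downwards, exactly [r - i] elements are taken when [i] is reached; [d]
    counts the indices already served. *)
Lemma nested_transversal (I : finType) (N : nat -> {set I}) r :
  (forall i, i <= r -> r - i < #|N i|) ->
  exists2 x : nat -> I, forall i, i <= r -> x i \in N i &
    forall i j, i <= r -> j <= r -> x i = x j -> i = j.
Proof.
move=> hN.
have x0 : I by have := hN r (leqnn r); rewrite subnn card_gt0 => /set0Pn/sigW[].
suff H d : d <= r.+1 -> exists2 x : nat -> I, forall i, r.+1 - d <= i <= r -> x i \in N i &
    forall i j, r.+1 - d <= i <= r -> r.+1 - d <= j <= r -> x i = x j -> i = j.
  by have [x] := H r.+1 (leqnn _); rewrite subnn; exists x.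
elim: d => [_|d IH hd].
  by exists (fun _ => x0) => [i|i j]; rewrite subn0 => /andP[h /(leq_trans h)]; rewrite ltnn.
have [x xN xI] := IH (ltnW hd); rewrite ltnS in hd.
have E : r.+1 - d = (r.+1 - d.+1).+1 by rewrite subSS subSn.
rewrite E in xN xI; rewrite subSS in xN xI *.
set a := r - d in xN xI *.
have [y yN yx] : exists2 y, y \in N a & y \notin [seq x i | i <- iota a.+1 d].
  apply/subsetPn; apply/negP => /subset_leq_card sN.
  have := leq_trans (hN a (leq_subr _ _)) (leq_trans sN (card_size _)).
  by rewrite size_map size_iota /a subKn // ltnn.
have yxi i : a < i <= r -> y != x i.
  move=> ai; apply: contraNneq yx => ->; apply: map_f; rewrite mem_iota.
  by move: ai; rewrite /a; lia.
exists (fun i => if i == a then y else x i).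
  move=> i /andP[ai ir]; have [->//|ia] := eqVneq i a.
  by apply: xN; rewrite ir andbT ltn_neqAle eq_sym ia.
move=> i j /andP[ai ir] /andP[aj jr].
have [ia|ia] := eqVneq i a; have [ja|ja] := eqVneq j a; first by rewrite ia ja.
- move=> E'; have /yxi : a < j <= r by rewrite jr andbT ltn_neqAle eq_sym ja.
  by rewrite E' eqxx.
- move=> E'; have /yxi : a < i <= r by rewrite ir andbT ltn_neqAle eq_sym ia.
  by rewrite E' eqxx.
- by apply: xI; rewrite ?ir ?jr andbT ltn_neqAle eq_sym ?ia ?ja.
Qed.

(** The first [i] terms are at most [q] and the others at most [r - i], so the left side is at most
    [i * q + (r - i) * (u + r - i)], where [u + r - i <= q]. *)
Lemma nested_sum_bound (N : nat -> nat) q r u i : i <= r -> q = u + r ->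
  (forall l, N l <= q) -> (forall l, i <= l <= r -> N l <= r - i) ->
  \sum_(l < r) N l + u * N r <= r * q.
Proof.
move=> ir qE Nq Ni.
have h1 : \sum_(l < r) N l <= i * q + (r - i) * (r - i).
  rewrite -(big_mkord xpredT) (big_cat_nat (n := i)) //=; apply: leq_add.
    rewrite -[leqRHS]/(i * q) -{2}[i]subn0 -sum_nat_const_nat.
    by apply: leq_sum => l _; exact: Nq.
  rewrite -[leqRHS]sum_nat_const_nat big_nat_cond [leqRHS]big_nat_cond.
  by apply: leq_sum => l /andP[/andP[il lr] _]; apply: Ni; rewrite il ltnW.
have h2 : u * N r <= u * (r - i) by rewrite leq_mul2l Ni ?orbT // ir leqnn.
apply: leq_trans (leq_add h1 h2) _.
rewrite -addnA -mulnDl -[X in _ <= X * _](subnKC ir) [leqRHS]mulnDl leq_add2l mulnC leq_mul2l.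
by rewrite qE; apply/orP; right; lia.
Qed.

(** Place [q = u + r] disjoint [k]-sets at random in [C] and let [N p i] count those lying in [G i].
    If [N p i > r - i] for all [i], distinct choices form a rainbow. So some [i] fails, by
    nestedness all later counts are at most [r - i] too, and [nested_sum_bound] applies to every
    placement; [averaging] converts counts into cardinalities. The weight [u] on the last family
    leaves room for the edges outside the first vertices. *)
Lemma cross_dependent_bound G k r u : k * (u + r) <= #|C| ->
  (forall i, i <= r -> G i \subset ksubsets C k) ->
  (forall i j, i <= j <= r -> G j \subset G i) ->
  (forall t, ~ rainbow G 0 r.+1 t) ->
  \sum_(i < r) #|G i| + u * #|G r| <= r * 'C(#|C|, k).
Proof.
move=> hk GK Gn nr.
set q := u + r in hk.
have [q0|q0] := posnP q.
  move: q0; rewrite /q => /eqP; rewrite addn_eq0 => /andP[/eqP -> /eqP ->].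
  by rewrite big_ord0.
have [f [fK fd]] := disjoint_ksubsets hk.
pose N (p : {perm T}) i := #|[set x : 'I_q | [set p y | y in f x] \in G i]|.
have key p : p \in placements C -> \sum_(i < r) N p i + u * N p r <= r * q.
  move=> pC.
  have Nq l : N p l <= q by rewrite -[leqRHS]card_ord max_card.
  have [/forallP hN|] := boolP [forall i : 'I_r.+1, r - i < N p i].
    have [|x xN xI] := @nested_transversal _ (fun i => [set x : 'I_q | [set p y | y in f x] \in G i]) r.
      by move=> i ir; exact: (hN (Ordinal (ir : i < r.+1))).
    case: (nr (fun i => [set p y | y in f (x i)])); split.
      by move=> i /andP[_ ir]; have := xN i ir; rewrite inE.
    move=> i j /andP[_ ir] /andP[_ jr] ij.
    rewrite -setI_eq0 -imsetI; last by move=> ? ? _ _; exact: perm_inj.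
    rewrite imset_eq0 setI_eq0; apply: fd; rewrite ?ltn_ord //.
    by apply: contraNneq ij => /val_inj/xI ->.
  rewrite negb_forall => /existsP[i]; rewrite -leqNgt => hi.
  have ir : i <= r by rewrite -ltnS.
  apply: (nested_sum_bound ir (erefl _) Nq) => l lr; apply: leq_trans hi.
  apply: subset_leq_card; apply/subsetP => z; rewrite !inE; exact: (subsetP (Gn _ _ lr)).
have avgE i : i <= r -> (\sum_(p in placements C) N p i) * 'C(#|C|, k)
   = #|placements C| * q * #|G i|.
  move=> ir; apply: (averaging (f := fun x : 'I_q => f x)); last exact: GK.
  by move=> x; apply: fK; exact: ltn_ord.
have P0 : 0 < #|placements C|.
  by rewrite card_gt0; apply/set0Pn; exists 1%g; rewrite inE perm_on1.
have : (\sum_(p in placements C) (\sum_(i < r) N p i + u * N p r)) * 'C(#|C|, k)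
   <= (#|placements C| * (r * q)) * 'C(#|C|, k).
  by rewrite leq_mul2r -sum_nat_const leq_sum ?orbT.
rewrite big_split /= -big_distrr /= exchange_big /= mulnDl -mulnA avgE // big_distrl /=.
rewrite (eq_bigr (fun i : 'I_r => #|placements C| * q * #|G i|)); last first.
  by move=> i _; rewrite avgE // ltnW.
rewrite -big_distrr /= [u * (_ * _)]mulnCA -mulnDr.
rewrite [r * q]mulnC mulnA -[leqRHS]mulnA leq_mul2l muln_eq0.
by rewrite !eqn0Ngt P0 q0.
Qed.

End CrossDependent.

(** * Links of the first vertices *)

Section Links.
Variable n : nat.
Implicit Types (H : {set {set 'I_n}}) (e A : {set 'I_n}).

Definition tail (m : nat) : {set 'I_n} := [set v : 'I_n | m <= v].
(** The index is a plain number, so that links form a sequence over [nat] and fit the rainbow lemmas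
    without proofs of [i < n]. *)
Definition adjoin (i : nat) A : {set 'I_n} := [set v : 'I_n | (v == i :> nat) || (v \in A)].
Definition link H (m i : nat) := [set A in ksubsets (tail m) 3 | adjoin i A \in H].
Definition inner H (m : nat) := [set e in H | e \subset tail m].

Lemma card_tail m : #|tail m| = n - m.
Proof.
rewrite -sum1_card (eq_bigl (fun v : 'I_n => m <= v)); last by move=> v; rewrite inE.
rewrite -(big_mkord (fun i => m <= i) (fun _ => 1)) -(big_nat_widenl m 0 n xpredT) //.
by rewrite sum_nat_const_nat muln1.
Qed.

Lemma link_sub H m i : link H m i \subset ksubsets (tail m) 3.
Proof. by apply/subsetP => A; rewrite inE => /andP[]. Qed.

Lemma adjoinE (i : 'I_n) A : adjoin i A = i |: A.
Proof. by apply/setP => v; rewrite !inE. Qed.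

Lemma notin_tail m (i : 'I_n) A : i < m -> A \subset tail m -> i \notin A.
Proof. by move=> im /subsetP sA; apply/negP => /sA; rewrite inE leqNgt im. Qed.

Lemma adjoin_inj m i (A B : {set 'I_n}) : i < m -> A \subset tail m -> B \subset tail m ->
  adjoin i A = adjoin i B -> A = B.
Proof.
move=> im /subsetP sA /subsetP sB /setP E; apply/setP => v.
have := E v; rewrite !inE; case: eqP => //= vi _.
have nv (D : {set 'I_n}) : {subset D <= tail m} -> (v \in D) = false.
  by move=> sD; apply/negP => /sD; rewrite inE vi leqNgt im.
by rewrite !nv.
Qed.

Lemma link_nested H m i j : shifted H -> m <= n -> i <= j -> j < m ->
  link H m j \subset link H m i.
Proof.
move=> sH mn ij jm; have [->|neq] := eqVneq i j; first exact: subxx.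
have {ij neq} ij : i < j by rewrite ltn_neqAle neq.
apply/subsetP => A; rewrite !inE => /andP[/andP[sA cA] AH]; rewrite sA cA /=.
have im := ltn_trans ij jm.
pose i' := Ordinal (leq_trans im mn); pose j' := Ordinal (leq_trans jm mn).
have iA : i' \notin A by exact: (@notin_tail m).
have jA : j' \notin A by exact: (@notin_tail m).
have nij : i' != j' by rewrite -val_eqE /= ltn_eqF.
have := sH (adjoin j' A) i' j' AH ij.
rewrite !adjoinE !inE eqxx (negPf nij) (negPf iA) => /(_ isT isT).
rewrite swapE ?inE ?eqxx ?(negPf nij) ?(negPf iA) // setU1K //.
by rewrite -adjoinE.
Qed.

(** Adjoining to each member of a rainbow its own index would give [s + 1] pairwise disjoint
    edges. *)
Lemma links_cross_dependent H s t : s < n -> matching_number H <= s ->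
  ~ rainbow (link H s.+1) 0 s.+1 t.
Proof.
move=> sn nuH [tL td].
pose f (i : 'I_s.+1) := adjoin i (t i).
have tT (i : 'I_s.+1) : t i \subset tail s.+1.
  by have := tL i (ltn_ord i); rewrite !inE => /andP[/andP[]].
have fd i j : i != j -> [disjoint f i & f j].
  move=> ij; apply/pred0P => v /=; rewrite !inE; apply/negP => /andP[].
  have tl (k : 'I_s.+1) : v \in t k -> s < v by move/(subsetP (tT k)); rewrite inE.
  case/predU1P=> [vi|vi] /predU1P[vj|vj].
  - by case/eqP: ij; apply: val_inj; rewrite /= -vi -vj.
  - by have := tl j vj; rewrite vi ltnNge -ltnS ltn_ord.
  - by have := tl i vi; rewrite vj ltnNge -ltnS ltn_ord.
  - by have /disjointFr/(_ vi) := td i j (ltn_ord i) (ltn_ord j) ij; rewrite vj.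
have fI : injective f.
  move=> i j E; apply/eqP; apply: contraT => ij; have := fd _ _ ij.
  have iE : Ordinal (leq_trans (ltn_ord i) sn) \in f i by rewrite inE eqxx.
  by move/disjointFr/(_ iE); rewrite -E iE.
have mM : matching H [set f i | i in 'I_s.+1].
  apply/matchingP; split.
    apply/subsetP => _ /imsetP[i _ ->]; have := tL i (ltn_ord i).
    by rewrite inE => /andP[].
  move=> _ _ /imsetP[i _ ->] /imsetP[j _ ->] ne; apply: fd.
  by apply: contraNneq ne => ->.
have := matching_numberP _ _ nuH _ mM.
by rewrite card_imset // card_ord ltnn.
Qed.

(* Local LYM: shiftedness puts the shadow of [inner H m.+1] inside the link of [m]. *)
Lemma inner_shadow H m : shifted H -> uniform 4 H -> m < n ->
  4 * #|inner H m.+1| <= (n - m.+1 - 3) * #|link H m.+1 m|.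
Proof.
move=> sH /forall_inP uH mn; pose i := Ordinal mn.
have -> : 4 * #|inner H m.+1| = \sum_(v in tail m.+1) \sum_(e in inner H m.+1) (v \in e).
  rewrite exchange_big /= mulnC -sum_nat_const; apply: eq_bigr => e.
  rewrite inE => /andP[eH se]; rewrite -(eqP (uH e eH)) -sum1_card big_mkcond /=.
  rewrite [RHS]big_mkcond /=; apply: eq_bigr => v _.
  have := subsetP se v; case: (v \in e) => [->//|_].
  by case: ifP.
have -> : (n - m.+1 - 3) * #|link H m.+1 m| =
    \sum_(v in tail m.+1) \sum_(A in link H m.+1 m) (v \notin A).
  rewrite exchange_big /= mulnC -sum_nat_const; apply: eq_bigr => A.
  rewrite !inE => /andP[/andP[sA /eqP cA] _].
  rewrite -card_tail -cA -(setIidPr sA) -cardsD -sum1_card big_mkcond [RHS]big_mkcond /=.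
  by apply: eq_bigr => v _; rewrite !inE; case: (v \in A); case: (m < v).
apply: leq_sum => v; rewrite inE => mv.
rewrite -!big_mkcondr !sum1_card.
pose f e := e :\ v.
have fI : {in [set e in inner H m.+1 | v \in e] &, injective f}.
  move=> e e'; rewrite !inE => /andP[_ ve] /andP[_ ve'] E.
  by rewrite -(setD1K ve) -(setD1K ve') -/(f e) E.
rewrite (_ : #|_| = #|[set e in inner H m.+1 | v \in e]|); last first.
  by apply: eq_card => e; rewrite [RHS]inE unfold_in.
rewrite -(card_in_imset fI); apply: subset_leq_card; apply/subsetP => A /imsetP[e].
rewrite inE => /andP[]; rewrite inE => /andP[eH se] ve ->; rewrite unfold_in /f.
rewrite !inE eqxx /= andbT (subset_trans (subsetDl _ _) se) /=.
have ie : i \notin e by exact: (@notin_tail m.+1).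
have /eqP := eqP (uH e eH); rewrite (cardsD1 v) ve add1n eqSS => -> /=.
by rewrite (_ : m = i) // adjoinE -swapE //; apply: sH.
Qed.

(** The non-edges meeting the first [m] vertices exactly in [i] (the sets [D i]) and those missing
    all of them ([D0]) are disjoint classes of non-edges; their sizes are complementary to those of
    the links and of [inner H m]. *)
Lemma edge_count H m : m <= n -> uniform 4 H ->
  #|H| + m * 'C(n - m, 3) + 'C(n - m, 4)
   <= 'C(n, 4) + \sum_(i < m) #|link H m i| + #|inner H m|.
Proof.
move=> mn /forall_inP uH.
have HK : H \subset ksubsets [set: 'I_n] 4.
  by apply/subsetP => e eH; rewrite inE subsetT uH.
pose K := ksubsets [set: 'I_n] 4 :\: H.
have cK : #|H| + #|K| = 'C(n, 4).
  have <- : #|ksubsets [set: 'I_n] 4| = 'C(n, 4) by rewrite card_ksubsets cardsT card_ord.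
  by rewrite -(cardsID H (ksubsets _ 4)) (setIidPr HK).
pose D (i : 'I_m) := [set adjoin i A | A in ksubsets (tail m) 3 :\: link H m i].
pose D0 := ksubsets (tail m) 4 :\: H.
have cD i : #|D i| + #|link H m i| = 'C(n - m, 3).
  rewrite card_in_imset; last first.
    move=> A B; rewrite !inE => /andP[_ /andP[sA _]] /andP[_ /andP[sB _]].
    exact: (@adjoin_inj m).
  by rewrite -card_tail -card_ksubsets addnC -(cardsID (link H m i) (ksubsets _ 3)) (setIidPr (link_sub _ _ _)).
have cD0 : #|D0| + #|inner H m| = 'C(n - m, 4).
  rewrite -card_tail -card_ksubsets addnC -(cardsID H (ksubsets _ 4)); congr (_ + _).
  apply: eq_card => e; rewrite !inE; case: (boolP (e \in H)) => eH; last by rewrite andbF.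
  by rewrite uH // !andbT.
have sDK : \sum_(i < m) #|D i| + #|D0| <= #|K|.
  have inD (i : 'I_m) e : e \in D i -> [/\ e \in K,
      Ordinal (leq_trans (ltn_ord i) mn) \in e &
      forall j : 'I_n, j \in e -> j < m -> j = i :> nat].
    case/imsetP=> A; rewrite !inE => /andP[nA /andP[sA cA]] ->.
    have im : Ordinal (leq_trans (ltn_ord i) mn) \notin A.
      by apply: (@notin_tail m) => //=; exact: ltn_ord.
    split; last 2 first.
    - by rewrite inE eqxx.
    - move=> j; rewrite inE => /predU1P[//|/(subsetP sA)].
      by rewrite inE leqNgt => /negPf ->.
    move: nA; rewrite sA cA /= => nA; rewrite subsetT nA /=.
    rewrite (_ : nat_of_ord i = Ordinal (leq_trans (ltn_ord i) mn)) // adjoinE.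
    by rewrite cardsU1 im (eqP cA).
  have inD0 e : e \in D0 -> e \in K /\ forall j : 'I_n, j \in e -> m <= j.
    rewrite /D0 /K !inE subsetT => /andP[-> /andP[/subsetP se ->]]; split=> // j /se.
    by rewrite inE.
  have -> : #|D0| = \sum_(e in K) (e \in D0).
    rewrite -sum1_card big_mkcond [RHS]big_mkcond /=; apply: eq_bigr => e _.
    by case: ifP => [/inD0[-> _]|] //; case: ifP.
  rewrite (eq_bigr (fun i => \sum_(e in K) (e \in D i : nat))); last first.
    move=> i _; rewrite -sum1_card big_mkcond [RHS]big_mkcond /=; apply: eq_bigr => e _.
    by case: ifP => [/inD[-> _ _]|] //; case: ifP.
  rewrite exchange_big /= -big_split /= -sum1_card; apply: leq_sum => e eK.
  have [eD0|eD0] := boolP (e \in D0).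
    rewrite big1 // => i _; case: (boolP (e \in D i)) => // /inD[_ ie _].
    by have [_ /(_ _ ie)] := inD0 e eD0; rewrite /= leqNgt ltn_ord.
  rewrite addn0; case: (pickP (fun i => e \in D i)) => [i eDi|none]; last first.
    by rewrite big1 // => i _; rewrite none.
  rewrite (bigD1 i) //= eDi big1 // => j ji; case: (boolP (e \in D j)) => // /inD[_ je _].
  have [_ _ /(_ _ je) /= E] := inD i e eDi.
  by case/eqP: ji; apply: val_inj; apply: E.
have : \sum_(i < m) #|D i| + \sum_(i < m) #|link H m i| = m * 'C(n - m, 3).
  by rewrite -big_split /= (eq_bigr (fun _ => 'C(n - m, 3))) ?sum_nat_const ?card_ord.
move: cK cD0 sDK; lia.
Qed.

End Links.

(** There are too many [k]-subsets avoiding [W] for all of them to be missing from [G]; this feeds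
    the greedy choice. *)
Lemma ksubset_avoiding (T : finType) (C : {set T}) k (G : {set {set T}}) (W : {set T}) w :
  #|ksubsets C k :\: G| < 'C(#|C| - w, k) -> #|W| <= w ->
  exists2 A, A \in G & [disjoint A & W].
Proof.
move=> hG hW.
have : ~~ (ksubsets (C :\: W) k \subset ksubsets C k :\: G).
  apply: contraL hG => /subset_leq_card; rewrite card_ksubsets -leqNgt; apply: leq_trans.
  apply: leq_bin2l; rewrite cardsD leq_sub2l //.
  exact: leq_trans (subset_leq_card (subsetIr _ _)) hW.
case/subsetPn => A; rewrite !inE subsetD => /andP[/andP[AC AW] cA].
by rewrite AC cA /= andbT negbK => AG; exists A.
Qed.

(** A rainbow of the links [j, ..., s] would extend greedily to the indices below [j], since these
    links contain the dense link of [j.-1]. Hence the links from [j] on are cross-dependent, and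
    their weighted bound pays for [inner H s.+1] through the shadow inequality. Below [j] the
    trivial bound on a link suffices. *)
Lemma near_extremal_bound n s j (H : {set {set 'I_n}}) :
  shifted H -> uniform 4 H -> matching_number H <= s -> s < n -> j <= s ->
  12 * (s - j) + 12 <= n - s.+1 ->
  (0 < j -> #|ksubsets (tail n s.+1) 3 :\: link H s.+1 j.-1| < 'C(n - s.+1 - 3 * s, 3)) ->
  #|H| <= 'C(n, 4) - 'C(n - s, 4).
Proof.
move=> sH uH nuH sn js hm dense.
(* As [sn] is [s.+1 <= n], the count is taken at [m = s + 1]; Pascal's rule [bS] then restores
   ['C(n - s, 4)]. *)
have := edge_count sn uH; have := inner_shadow sH uH sn.
have cC : #|tail n s.+1| = n - s.+1 := card_tail n s.+1.
have bS : 'C(n - s, 4) = 'C(n - s.+1, 4) + 'C(n - s.+1, 3) by rewrite -[n - s]subnSK // binS.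
pose L i := link H s.+1 i.
have nested i i' : i <= i' -> i' <= s -> L i' \subset L i.
  by move=> ii' i's; apply: link_nested.
have no_rainbow t : ~ rainbow L j s.+1 t.
  move=> rt; have [||t' /links_cross_dependent] :=
    @rainbow_greedy _ (tail n s.+1) L 3 0 j s.+1 t (leq0n _) rt.
  - by move=> i _; exact: link_sub.
  - move=> i W /= ij hW.
    have j0 : 0 < j by apply: leq_ltn_trans ij.
    have := dense j0; rewrite -cC => {}dense.
    have [|A AL AW] := ksubset_avoiding dense (W := W).
      by apply: leq_trans hW _; rewrite leq_mul2l /= subSS leq_subr.
    exists A => //; apply: subsetP AL; apply: nested; lia.
  - by apply.
(* The shadow inequality gives at most [(n - s.+1) %/ 4 * #|L s|] inner edges; the extra 1 in [u]
   pays for [L s] itself, the last term of the sum. The room [3 * (u + r) <= n - s.+1] is what [hm]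
   provides. *)
pose r := s - j; pose u := (n - s.+1) %/ 4 + 1.
have : \sum_(i < r) #|L (j + i)| + u * #|L (j + r)| <= r * 'C(#|tail n s.+1|, 3).
  apply: (@cross_dependent_bound _ _ (fun i => L (j + i)) 3 r u).
  - by rewrite cC /r /u; lia.
  - by move=> i _; exact: link_sub.
  - by move=> i i' /andP[ii' i'r]; apply: nested; rewrite /r in i'r *; lia.
  - move=> t [tL td]; apply: (no_rainbow (fun i => t (i - j))); split.
      move=> i ij; have := tL (i - j); rewrite subnKC; last by lia.
      by apply; rewrite /r; lia.
    by move=> i i' ij ij' ne; apply: td; rewrite /r; lia.
rewrite cC (_ : j + r = s); last by rewrite /r subnKC.
have : \sum_(i < j) #|L i| <= j * 'C(n - s.+1, 3).
  rewrite -[j in leqRHS]card_ord -sum_nat_const; apply: leq_sum => i _.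
  by rewrite -cC -card_ksubsets; apply: subset_leq_card; exact: link_sub.
have -> : \sum_(i < s.+1) #|link H s.+1 i| =
    \sum_(i < j) #|L i| + \sum_(i < r) #|L (j + i)| + #|L s|.
  rewrite big_ord_recr /= -/(L s); congr (_ + _).
  rewrite -(big_mkord xpredT (fun i => #|link H s.+1 i|)) (big_cat_nat (n := j)) //=.
  rewrite big_mkord; congr (_ + _).
  by rewrite -{1}[j]add0n big_addn big_mkord; apply: eq_bigr => i _; rewrite addnC.
have -> : #|link H s.+1 s| = #|L s| by [].
move=> h1 h2 h3 h4.
have h5 : #|inner H s.+1| <= (n - s.+1) %/ 4 * #|L s|.
  rewrite -(leq_pmul2l (isT : 0 < 4)) mulnA; apply: leq_trans h3 _.
  by rewrite leq_mul2r; apply/orP; right; lia.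
have h6 : u * #|L s| = (n - s.+1) %/ 4 * #|L s| + #|L s| by rewrite mulnDl mul1n.
have h7 : s.+1 * 'C(n - s.+1, 3) = j * 'C(n - s.+1, 3) + r * 'C(n - s.+1, 3) + 'C(n - s.+1, 3).
  by rewrite -mulnDl mulSn addnC /r subnKC.
rewrite leq_subRL; last by apply: leq_bin2l; exact: leq_subr.
by rewrite bS; move: h1 h2 h4 h5 h6 h7; lia.
Qed.

(** * Dominance order on shifted families *)

Section Dominance.
Variable n : nat.
Implicit Types (H : {set {set 'I_n}}) (e f : {set 'I_n}).

Definition initial (k : nat) : {set 'I_n} := [set v : 'I_n | v < k].

(** Let [v] be the least element of [e] outside [f]. Comparing prefixes at [v.+1] yields [y < v] in
    [f] but not in [e]. Exchanging [v] for [y] keeps the dominance: prefixes up to [v] lie inside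
    [f], and longer ones keep their size. *)
Lemma shifted_dominated H e f : shifted H -> e \in H -> #|f| = #|e| ->
  (forall k, #|e :&: initial k| <= #|f :&: initial k|) -> f \in H.
Proof.
move=> sH; have [d] := ubnP #|e :\: f|; elim: d e => // d IH e hd eH cf dom.
have [ef|/subsetPn[v0 v0e v0f]] := boolP (e \subset f).
  suff -> : f = e by [].
  by apply/esym/eqP; rewrite eqEcard ef cf leqnn.
have v0P : (v0 \in e) && (v0 \notin f) by rewrite v0e.
case: (@arg_minnP _ v0 (fun v => (v \in e) && (v \notin f)) (@nat_of_ord n) v0P).
move=> v /andP[ve vf] vmin.
have below w : w \in e -> w < v -> w \in f.
  move=> we wv; apply: contraLR wv => wf; rewrite -leqNgt; apply: vmin.
  by rewrite we wf.
have [y yf /andP[ye yv]] : exists2 y, y \in f & (y \notin e) && (y < v).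
  have : ~~ (f :&: initial v.+1 \subset (e :&: initial v.+1) :\ v).
    apply/negP => /subset_leq_card h; have := leq_trans (dom v.+1) h.
    by rewrite [X in X <= _](cardsD1 v) !inE ve ltnSn ltnn.
  case/subsetPn => y; rewrite !inE ltnS => /andP[yf yv].
  rewrite yv andbT negb_and negbK => hy; exists y => //.
  have yv' : y != v by apply: contraNneq vf => <-.
  move: hy; rewrite (negPf yv') => /= ->.
  by rewrite ltn_neqAle yv andbT -val_eqE in yv' *; rewrite yv'.
apply: (IH (swap y v e)).
- rewrite ltnS in hd; apply: leq_trans hd; apply: proper_card; apply/properP; split.
    apply/subsetP => w; rewrite swapE // !inE => /andP[wf].
    by rewrite wf => /predU1P[wy|/andP[_ ->//]]; rewrite wy yf in wf.
  exists v; first by rewrite !inE ve vf.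
  by rewrite swapE // !inE eqxx vf /= orbF; apply: contraNN vf => /eqP ->.
- exact: sH.
- by rewrite cf card_imset //; exact: perm_inj.
- move=> k; have [kv|vk] := leqP k v.
    apply: subset_leq_card; apply/subsetP => w; rewrite swapE // !inE => /andP[h wk].
    rewrite wk andbT; case/predU1P: h => [->//|/andP[_ we]].
    by apply: below => //; exact: leq_trans kv.
  have -> : swap y v e :&: initial k = [set tperm y v w | w in e :&: initial k].
    rewrite imsetI; last by move=> ? ? _ _; exact: perm_inj.
    congr (_ :&: _); apply/setP => w; rewrite -[[set _ | _ in _]]/(swap y v _) mem_swap !inE.
    by case: tpermP => [->|->|_ _] //; rewrite vk (ltn_trans yv vk).
  by rewrite card_imset //; exact: perm_inj.
Qed.

Lemma shifted_le_imset (I : finType) H (x y : I -> 'I_n) : shifted H ->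
  injective x -> injective y -> (forall j, y j <= x j) ->
  [set x j | j in I] \in H -> [set y j | j in I] \in H.
Proof.
move=> sH xI yI yx xH; apply: (shifted_dominated sH xH); first by rewrite !card_imset.
move=> k.
have E (z : I -> 'I_n) : injective z ->
    #|[set z j | j in I] :&: initial k| = #|[set j | z j < k]|.
  move=> zI; rewrite -(card_imset _ zI); apply: eq_card => v; apply/idP/idP.
    by rewrite !inE => /andP[/imsetP[j _ ->] jk]; apply: imset_f; rewrite inE.
  by case/imsetP=> j; rewrite inE => jk ->; rewrite !inE jk imset_f.
rewrite !E //; apply: subset_leq_card; apply/subsetP => j; rewrite !inE.
exact: leq_ltn_trans.
Qed.

End Dominance.

(** * Realizing integral block matchings *)

Section Rounding.
Variables (n B L : nat).
Hypothesis BLn : B * L <= n.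

(** Block [b] is the interval from [b * L] to [b.+1 * L - 1]. Some edge lies coordinatewise beyond
    the blocks [a j], so in a shifted family any distinct vertices taken from these blocks form an
    edge; blocks may repeat. *)
Definition block_edge (H : {set {set 'I_n}}) (a : {ffun 'I_4 -> 'I_B}) : bool :=
  [exists x : {ffun 'I_4 -> 'I_n}, [&& injectiveb x, [set x j | j in 'I_4] \in H &
     [forall j, (a j).+1 * L <= x j]]].

(** Take [m e] copies of each block edge. A block has at most [L] slots to serve, so each slot gets
    a private vertex, the one whose offset is the slot's rank in its block; the resulting edges are
    disjoint. *)
Lemma block_matching (H : {set {set 'I_n}}) (J : finType)
    (a : J -> {ffun 'I_4 -> 'I_B}) (m : J -> nat) :
  shifted H -> (forall e, block_edge H (a e)) ->
  (forall i, \sum_e m e * #|[set j | a e j == i]| <= L) ->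
  \sum_e m e <= matching_number H.
Proof.
move=> sH aH cap.
pose copies := {e : J & 'I_(m e)}.
pose blk (p : copies * 'I_4) : 'I_B := a (tag p.1) p.2.
pose slots i := [set p | blk p == i].
have card_slots i : #|slots i| <= L.
  apply: leq_trans (cap i).
  rewrite -sum1_card (eq_bigl (fun p => blk p == i)); last by move=> p; rewrite inE.
  rewrite big_mkcond /= -(pair_bigA _ (fun (q : copies) (j : 'I_4) => if a (tag q) j == i then 1 else 0)) /=.
  rewrite -(sig_big_dep (fun _ => true) (fun _ _ => true)
     (fun (e : J) (c : 'I_(m e)) => \sum_j if a e j == i then 1 else 0)) /=.
  apply: leq_sum => e _; rewrite sum_nat_const card_ord leq_mul2l; apply/orP; right.
  by rewrite -big_mkcond sum1_card; apply: eq_leq; apply: eq_card => j; rewrite inE.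
pose rank p := index p (enum (slots (blk p))).
have rank_lt p : rank p < L.
  by apply: leq_trans (card_slots (blk p)); rewrite cardE index_mem mem_enum inE.
have pos_lt p : blk p * L + rank p < n.
  apply: leq_trans BLn; apply: leq_trans (leq_mul (ltn_ord (blk p)) (leqnn L)).
  by rewrite mulSn addnC ltn_add2r.
pose pos p : 'I_n := Ordinal (pos_lt p).
have pos_inj : injective pos.
  move=> p p' /(congr1 val) /= E; have L0 : 0 < L by apply: leq_ltn_trans (rank_lt p).
  have Eb : blk p = blk p'.
    apply: val_inj => /=; have := congr1 (divn^~ L) E.
    by rewrite !divnMDl // !divn_small // !addn0.
  move: E; rewrite Eb => /addnI; rewrite /rank Eb => /(congr1 (nth p (enum (slots (blk p'))))).
  by rewrite !nth_index ?mem_enum ?inE ?Eb.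
pose edge (q : copies) := [set pos (q, j) | j in 'I_4].
have edgeH q : edge q \in H.
  have /existsP[x /and3P[/injectiveP xI xH /forallP ax]] := aH (tag q).
  apply: (shifted_le_imset sH xI _ _ xH).
    by move=> j j' /pos_inj [].
  move=> j; apply: leq_trans (ax j) => /=; rewrite mulSn addnC leq_add2r.
  exact: ltnW.
have edge_disj q q' : q != q' -> [disjoint edge q & edge q'].
  move=> qq'; apply/pred0P => v /=; apply/negP => /andP[/imsetP[j _ ->] /imsetP[j' _]].
  by case/pos_inj => E _; rewrite E eqxx in qq'.
have edge_inj : injective edge.
  move=> q q' E; apply/eqP; apply: contraT => /edge_disj; rewrite E -setI_eq0 setIid.
  by move/set0Pn; case; exists (pos (q', ord0)); apply: imset_f.
have mM : matching H [set edge q | q : copies].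
  apply/matchingP; split.
    by apply/subsetP => _ /imsetP[q _ ->].
  move=> _ _ /imsetP[q _ ->] /imsetP[q' _ ->] ne; apply: edge_disj.
  by apply: contraNneq ne => ->.
have := matching_numberP _ _ (leqnn _) _ mM; rewrite card_imset //.
rewrite card_tagged sumnE big_map big_enum /=; apply: leq_trans.
by apply: eq_leq; apply: eq_bigr => e _; rewrite card_ord.
Qed.

End Rounding.

(** * Edges versus ordered tuples *)

Section OrderedCounts.
Variable C : finType.
Implicit Types (E : {set {set C}}).

Definition orderings k E : {set {ffun 'I_k -> C}} :=
  [set g : {ffun 'I_k -> C} | injectiveb g && ([set g j | j in 'I_k] \in E)].

Lemma card_orderings k E : (forall e, e \in E -> #|e| = k) ->
  #|orderings k E| = k`! * #|E|.
Proof.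
move=> Ek.
have -> : #|orderings k E| =
    \sum_(e in E) #|[set g in ffun_on (mem e) | injectiveb (g : {ffun 'I_k -> C})]|.
  rewrite -sum1_card (partition_big (fun g : {ffun 'I_k -> C} => [set g j | j in 'I_k])
    (mem E)) /=; last by move=> g; rewrite inE => /andP[].
  apply: eq_bigr => e eE; rewrite sum1_card; apply: eq_card => g; rewrite unfold_in !inE.
  apply/andP/andP => [[/andP[gI _] /eqP <-]|[/ffun_onP ge gI]].
    by split=> //; apply/ffun_onP => j; apply: imset_f.
  have -> : [set g j | j in 'I_k] = e; last by rewrite gI eE.
  apply/eqP; rewrite eqEcard (Ek e eE) card_imset ?card_ord ?leqnn ?andbT; last exact/injectiveP.
  by apply/subsetP => _ /imsetP[j _ ->]; exact: ge.
rewrite mulnC -sum_nat_const; apply: eq_bigr => e eE.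
by rewrite card_inj_ffuns_on card_ord (Ek e eE) ffactnn.
Qed.

Definition tuple4 (g : {ffun 'I_4 -> C}) : C * C * C * C :=
  (g (inord 0), g (inord 1), g (inord 2), g (inord 3)).

Lemma tuple4_inj : injective tuple4.
Proof.
move=> g h [E0 E1 E2 E3]; apply/ffunP => j; rewrite -(inord_val j).
by case: j => [[|[|[|[|j]]]]].
Qed.

Lemma quadruple_count E (P : pred (C * C * C * C)) : (forall e, e \in E -> #|e| = 4) ->
  (forall x y z w, [set v in [:: x; y; z; w]] \in E -> uniq [:: x; y; z; w] -> P (x, y, z, w)) ->
  24 * #|E| <= #|P|.
Proof.
move=> E4 EP; rewrite -[24]/(4`!) -card_orderings // -(card_imset _ tuple4_inj).
apply: subset_leq_card; apply/subsetP => p /imsetP[g]; rewrite inE => /andP[/injectiveP gI gE] ->.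
rewrite unfold_in; apply: EP.
  suff -> : [set v in [:: g (inord 0); g (inord 1); g (inord 2); g (inord 3)]] =
    [set g j | j in 'I_4] by [].
  apply/setP => v; rewrite !inE; apply/idP/imsetP => [|[j _ ->]].
    by case/or4P=> /eqP ->; [exists (inord 0)|exists (inord 1)|exists (inord 2)|exists (inord 3)].
  by rewrite -(inord_val j); case: j => [[|[|[|[|j]]]]] //= _; rewrite eqxx ?orbT.
by rewrite /= !inE !(inj_eq gI) -!val_eqE /= !inordK.
Qed.

(** Triples with distinct entries are orderings of members of [E], six for each. The others have two
    equal entries and lie in one of three images of the set of pairs. *)
Lemma triple_count E (P : pred (C * C * C)) : (forall e, e \in E -> #|e| = 3) ->
  (forall x y z, uniq [:: x; y; z] -> P (x, y, z) -> [set v in [:: x; y; z]] \in E) ->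
  #|P| <= 6 * #|E| + 3 * #|C| ^ 2.
Proof.
move=> E3 PE.
pose t3 (g : {ffun 'I_3 -> C}) := (g (inord 0), g (inord 1), g (inord 2)).
pose d (i : 'I_3) (p : C * C) := if val i is 0 then (p.1, p.1, p.2) else
  if val i is 1 then (p.1, p.2, p.1) else (p.2, p.1, p.1).
pose D (i : 'I_3) := [set d i p | p : C * C].
have cover : P \subset (t3 @: orderings 3 E) :|: \bigcup_i D i.
  apply/subsetP => -[[x y] z]; rewrite unfold_in => Pp; rewrite inE.
  have [u|] := boolP (uniq [:: x; y; z]).
    apply/orP; left; apply/imsetP; exists [ffun j : 'I_3 => nth x [:: x; y; z] j].
      rewrite inE; apply/andP; split.
        apply/injectiveP => i j; rewrite !ffunE => /eqP; rewrite nth_uniq //.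
        by move=> /eqP /val_inj.
      have -> : [set [ffun j : 'I_3 => nth x [:: x; y; z] j] j | j in 'I_3] = [set v in [:: x; y; z]].
        apply/setP => v; apply/imsetP/idP => [[j _ ->]|].
          by rewrite inE ffunE mem_nth.
        rewrite inE => vi; have vj : index v [:: x; y; z] < 3 by rewrite index_mem.
        by exists (Ordinal vj); rewrite // ffunE nth_index.
      exact: PE.
    by rewrite /t3 !ffunE !inordK.
  rewrite /= !inE => h; apply/orP; right; apply/bigcupP.
  have [xy|xy] := eqVneq x y.
    by exists (inord 0) => //; apply/imsetP; exists (x, z); rewrite // /d /= inordK // -xy.
  have [xz|xz] := eqVneq x z.
    by exists (inord 1) => //; apply/imsetP; exists (x, y); rewrite // /d /= inordK // -xz.
  have [yz|yz] := eqVneq y z; last by rewrite (negPf xy) (negPf xz) (negPf yz) in h.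
  by exists (inord 2) => //; apply/imsetP; exists (y, x); rewrite // /d /= inordK // -yz.
apply: leq_trans (subset_leq_card cover) _.
rewrite cardsU; apply: leq_trans (leq_subr _ _) _; apply: leq_add.
  by apply: leq_trans (leq_imset_card _ _) _; rewrite card_orderings.
apply: leq_trans (card_bigcup_le _ _) _.
rewrite -[3 in leqRHS]card_ord -sum_nat_const; apply: leq_sum => i _.
by apply: leq_trans (leq_imset_card _ _) _; rewrite card_prod mulnn.
Qed.

End OrderedCounts.

Import Order.TTheory GRing.Theory Num.Theory.
Local Open Scope ring_scope.

(** * Fractional covers *)

Section Farkas.
Variables (F : realFieldType) (V W : lmodType F) (dot : V -> W -> F).
Hypothesis dotDl : forall a b x, dot (a + b) x = dot a x + dot b x.
Hypothesis dotZl : forall c a x, dot (c *: a) x = c * dot a x.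
Hypothesis dotDr : forall a x y, dot a (x + y) = dot a x + dot a y.
Hypothesis dotZr : forall c a x, dot a (c *: x) = c * dot a x.
Hypothesis dot_separates : forall a, a != 0 -> exists x, dot a x != 0.

(** The conic hull of a list, with one coefficient peeled off at a time to suit induction on the
    list. *)
Fixpoint cone (A : seq V) (b : V) : Prop :=
  if A is a :: A' then exists2 c, 0 <= c & cone A' (b - c *: a) else b = 0.

Lemma cone_shift (a : V) (phi : V -> F) (A : seq V) (b : V) :
  {in A, forall g, 0 <= phi g} -> cone [seq g + phi g *: a | g <- A] b ->
  exists2 c, 0 <= c & cone A (b - c *: a).
Proof.
elim: A b => [|g A IH] b phi0 /=; first by move=> ->; exists 0; rewrite // scale0r subr0.
case=> c c0 /IH [h gA|c' c'0 Hc']; first by apply: phi0; rewrite inE gA orbT.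
exists (c * phi g + c').
  by rewrite addr_ge0 // mulr_ge0 // phi0 // mem_head.
exists c => //.
suff -> : b - (c * phi g + c') *: a - c *: g = b - c *: (g + phi g *: a) - c' *: a by [].
by rewrite scalerDr scalerA scalerDl !opprD !addrA [LHS]addrAC; congr (_ - _); rewrite addrAC.
Qed.

(** Induction on the number of generators. If [x] separates [b] from the tail but is negative on
    [a], rescale it to [y] with [dot a y = -1] and project along [a] to the kernel of [y]. A cone
    representation of the projections lifts by [cone_shift]; a separating [x'] is corrected by a
    multiple of [y] so as to vanish on [a]. *)
Lemma farkas_seq (A : seq V) (b : V) :
  cone A b \/ exists2 x, {in A, forall a, 0 <= dot a x} & dot b x < 0.
Proof.
have [n] := ubnP (size A); elim: n A b => // n IH [|a A] b /= sA.
  have [->|/dot_separates [x]]:= eqVneq b 0; [by left | ].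
  rewrite neq_lt => hx; right; case/orP: hx => [hx|hx]; first by exists x.
  by exists (-1 *: x) => //; rewrite dotZr mulN1r oppr_lt0.
have [Hb|[x Ax bx]] := IH A b sA.
  by left; exists 0; rewrite // scale0r subr0.
have [ax|ax] := lerP 0 (dot a x).
  by right; exists x => // g; rewrite inE => /predU1P[->|/Ax].
pose y := (- dot a x)^-1 *: x.
have ay : dot a y = -1.
  by rewrite dotZr -[X in _ * X]opprK mulrN mulVf // oppr_eq0 lt_eqF.
have Nax : 0 < (- dot a x)^-1 by rewrite invr_gt0 oppr_gt0.
have Ay : {in A, forall g, 0 <= dot g y}.
  by move=> g gA; rewrite dotZr mulr_ge0 ?Ax // ltW.
have by0 : dot b y < 0 by rewrite dotZr pmulr_rlt0.
clearbody y; have [|Hc|[x' Ax' bx']] := IH [seq g + dot g y *: a | g <- A] (b + dot b y *: a).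
- by rewrite size_map.
- have [c c0 Hc'] := cone_shift Ay Hc.
  left; exists (c - dot b y); first by rewrite subr_ge0 (le_trans (ltW by0)).
  suff -> : b - (c - dot b y) *: a = b + dot b y *: a - c *: a by [].
  by rewrite scalerBl opprB addrA.
right; exists (x' + dot a x' *: y).
  move=> g; rewrite inE => /predU1P[->|gA]; rewrite dotDr dotZr.
    by rewrite ay mulrN1 subrr.
  by have := Ax' _ (map_f _ gA); rewrite dotDl dotZl mulrC.
by move: bx'; rewrite dotDl dotZl dotDr dotZr [dot a x' * _]mulrC.
Qed.

Lemma cone_sum (J : eqType) (g : J -> V) (s : seq J) (b : V) :
  uniq s -> cone [seq g j | j <- s] b ->
  exists2 y : J -> F, forall j, 0 <= y j & b = \sum_(j <- s) y j *: g j.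
Proof.
elim: s b => [|j s IH] b /=; first by move=> _ ->; exists (fun=> 0); rewrite ?big_nil.
case/andP=> js us [c c0 /(IH _ us) [y y0 Hy]].
exists (fun i => if i == j then c else y i) => [i|]; first by case: ifP.
rewrite big_cons eqxx -[LHS](subrK (c *: g j)) Hy addrC; congr (_ + _).
by apply: eq_big_seq => i /[dup] is_; case: eqVneq => // ->; rewrite (negPf js).
Qed.

Lemma farkas (J : finType) (g : J -> V) (b : V) :
  (exists2 y : J -> F, forall j, 0 <= y j & b = \sum_j y j *: g j) \/
  (exists2 x, forall j, 0 <= dot (g j) x & dot b x < 0).
Proof.
have [/cone_sum H|[x Hx bx]] := farkas_seq [seq g j | j <- index_enum J] b.
  by left; apply: H; exact: index_enum_uniq.
by right; exists x => // j; apply: Hx; apply: map_f; rewrite mem_index_enum.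
Qed.

End Farkas.

(** Farkas' lemma for the target [(1, ..., 1, -v)], with generators the unit vectors (slack in the
    capacities) and the rows of [M] extended by [-1]. A conic representation is a fractional
    matching of weight [v]; a separating vector [(x, z)] has [z > 0], and [x / z] is a cover lighter
    than [v]. *)
Lemma cover_matching_duality (F : realFieldType) (I J : finType) (M : J -> I -> F) (v : F) :
  0 < v ->
  (exists2 w : I -> F, (forall i, 0 <= w i) /\ \sum_i w i < v &
     forall j, 1 <= \sum_i M j i * w i) \/
  (exists2 y : J -> F, (forall j, 0 <= y j) /\ \sum_j y j = v &
     forall i, \sum_j y j * M j i <= 1).
Proof.
move=> v0.
pose V : lmodType F := ({ffun I -> F^o} * F^o)%type.
pose dot (a x : V) : F := \sum_i a.1 i * x.1 i + a.2 * x.2.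
have dotDl a b x : dot (a + b) x = dot a x + dot b x.
  rewrite /dot addrACA -big_split /= -mulrDl; congr (_ + _).
  by apply: eq_bigr => i _; rewrite ffunE mulrDl.
have dotC a x : dot a x = dot x a.
  by rewrite /dot [a.2 * _]mulrC; congr (_ + _); apply: eq_bigr => i _; rewrite mulrC.
have dotZl c a x : dot (c *: a) x = c * dot a x.
  rewrite /dot mulrDr mulr_sumr mulrA; congr (_ + _).
  by apply: eq_bigr => i _; rewrite ffunE mulrA.
have dotDr a x y : dot a (x + y) = dot a x + dot a y by rewrite dotC dotDl !(dotC a).
have dotZr c a x : dot a (c *: x) = c * dot a x by rewrite dotC dotZl (dotC a).
have dot_sep (a : V) : a != 0 -> exists x, dot a x != 0.
  move=> a0; exists a; apply: contraNneq a0; rewrite /dot => /eqP.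
  rewrite paddr_eq0 ?sumr_ge0 //; last 2 first.
  - by move=> i _; rewrite -expr2 sqr_ge0.
  - by rewrite -expr2 sqr_ge0.
  rewrite psumr_eq0; last by move=> i _; rewrite -expr2 sqr_ge0.
  case/andP=> /allP a1; rewrite mulf_eq0 orbb => /eqP a2.
  apply/eqP; rewrite [a]surjective_pairing a2 -[RHS]/((0, 0) : V); congr pair; apply/ffunP => i; rewrite ffunE.
  by have := a1 i (mem_index_enum _); rewrite mulf_eq0 orbb => /eqP.
pose unit_vec i : {ffun I -> F^o} := [ffun i' => (i' == i)%:R].
pose g (k : I + J) : V := match k with
  | inl i => (unit_vec i, 0) | inr j => ([ffun i => M j i], -1) end.
have dot_unit i x : dot (g (inl i)) x = x.1 i.
  rewrite /dot /= mul0r addr0 (bigD1 i) //= ffunE eqxx mul1r big1 ?addr0 //.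
  by move=> i' /negPf ne; rewrite ffunE ne mul0r.
have dot_edge j x : dot (g (inr j)) x = \sum_i M j i * x.1 i - x.2.
  by rewrite /dot /= mulN1r; congr (_ - _); apply: eq_bigr => i _; rewrite ffunE.
have [[y y0 Hy]|[x gx bx]] := farkas dotDl dotZl dotDr dotZr dot_sep g ([ffun=> 1], - v).
  right; exists (fun j => y (inr j)); first split=> [j|]; first exact: y0.
    have := congr1 snd Hy; rewrite /= raddf_sum big_sumType /= big1 ?add0r; last first.
      by move=> i _; rewrite scaler0.
    move=> /(congr1 -%R); rewrite opprK => ->; rewrite -sumrN; apply: eq_bigr => j _.
    by rewrite /= scalerN opprK; rewrite /GRing.scale /= mulr1.
  move=> i; have := congr1 (fun p : V => p.1 i) Hy; rewrite /= ffunE raddf_sum sum_ffunE.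
  rewrite big_sumType /= => Hi.
  have {Hi} -> : \sum_j y (inr j) * M j i = 1 - \sum_i' y (inl i') * (i == i')%:R.
    rewrite [X in X - _]Hi addrAC.
    have -> : \sum_i0 (y (inl i0) *: unit_vec i0) i = \sum_i' y (inl i') * (i == i')%:R.
      by apply: eq_bigr => i' _; rewrite !ffunE.
    by rewrite subrr add0r; apply: eq_bigr => j _; rewrite !ffunE.
  by rewrite lerBlDr lerDl sumr_ge0 // => j _; rewrite mulr_ge0.
left; pose z := x.2.
have x0 i : 0 <= x.1 i by rewrite -(dot_unit i).
have hs : \sum_i x.1 i < v * z.
  move: bx; rewrite /dot /= mulNr subr_lt0; congr (_ < _).
  by apply: eq_bigr => i _; rewrite ffunE mul1r.
have z0 : 0 < z by rewrite -(pmulr_rgt0 _ v0); apply: le_lt_trans hs; exact: sumr_ge0.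
exists (fun i => x.1 i / z); first split=> [i|].
- by rewrite divr_ge0 // ltW.
- by rewrite -mulr_suml ltr_pdivrMr.
move=> j; have := gx (inr j); rewrite dot_edge subr_ge0 -/z => hz.
rewrite -(ler_pM2r z0) mul1r mulr_suml; apply: le_trans hz _.
by apply: ler_sum => i _; rewrite -mulrA divfK // gt_eqF.
Qed.

Lemma block_cover n B L s (H : {set {set 'I_n}}) :
  (B * L <= n)%N -> (0 < L)%N -> shifted H -> (matching_number H <= s)%N ->
  exists2 w : 'I_B -> rat, (forall i, 0 <= w i) /\ (\sum_i w i) * L%:R <= (s + 1 + B ^ 4)%:R &
    forall a : {ffun 'I_4 -> 'I_B}, block_edge L H a -> 1 <= \sum_j w (a j).
Proof.
move=> BLn L0 sH nuH.
pose J := {a : {ffun 'I_4 -> 'I_B} | block_edge L H a}.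
pose mult (e : J) (i : 'I_B) := #|[set j | val e j == i]|.
have LQ : (0 : rat) < L%:R by rewrite ltr0n.
have cJ : (#|{: J}| <= B ^ 4)%N.
  rewrite -[(B ^ 4)%N](_ : #|{ffun 'I_4 -> 'I_B}| = _); last by rewrite card_ffun !card_ord.
  by rewrite card_sig; exact: max_card.
(* A fractional matching of weight [v], scaled by [L] and rounded down, loses at most 1 per block
   edge, so [#|J|] in all; the further 1 makes the result exceed [s]. *)
pose v : rat := (s + 1 + #|{: J}|)%:R / L%:R.
have v0 : 0 < v by rewrite divr_gt0 // ltr0n addn1.
have [[w [w0 sw] cov]|[y [y0 sy] cap]] :=
  cover_matching_duality (fun e i => (mult e i)%:R) v0.
  exists w.
    split=> //; have := ltW sw; rewrite -(ler_pM2r LQ) divfK ?gt_eqF // => h.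
    by apply: le_trans h _; rewrite ler_nat leq_add2l.
  move=> a aH; apply: le_trans (cov (exist _ a aH)) _.
  rewrite (eq_bigr (fun i => \sum_j (if a j == i then w i else 0))); last first.
    move=> i _; rewrite -big_mkcond sumr_const -[RHS]mulr_natl; congr (_%:R * _).
    by apply: eq_card => j; rewrite inE.
  rewrite exchange_big /=; apply: ler_sum => j _; rewrite (bigD1 (a j)) //= eqxx big1 ?addr0 //.
  by move=> i; rewrite eq_sym => /negPf ->.
pose m e := Num.truncn (L%:R * y e).
have m_le e : (m e)%:R <= L%:R * y e by rewrite truncn_le mulr_ge0 // ltW.
have h : (\sum_e m e <= matching_number H)%N.
  apply: (@block_matching n B L BLn H J val m sH); first by case.
  move=> i; rewrite -(ler_nat rat) natr_sum.
  apply: le_trans (_ : \sum_e L%:R * (y e * (mult e i)%:R) <= _).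
    by apply: ler_sum => e _; rewrite natrM mulrA ler_wpM2r.
  by rewrite -mulr_sumr ler_piMr // ltW.
exfalso; have := leq_trans h nuH; apply/negP; rewrite -ltnNge.
rewrite -(ltn_add2r #|{: J}|) -(ltr_nat rat).
have -> : (s + #|{: J}|)%:R = L%:R * v - 1.
  by rewrite /v mulrC divfK ?gt_eqF // [in RHS]addnAC [in RHS]natrD addrK.
rewrite -sy mulr_sumr natrD natr_sum -sum1_card natr_sum -big_split /=.
apply: (@lt_le_trans _ _ (\sum_e L%:R * y e)); first by rewrite ltrBlDr ltrDl.
by apply: ler_sum => e _; rewrite -natrD addn1 ltW // truncnS_gt.
Qed.

(* An edge with vertices in the blocks [b_1, ..., b_4], all positive, forces every
   edge transversal to the blocks [b_j - 1] into [H].  Hence a cover of the block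
   edges, shifted by one block and made monotone by running minima, covers [H]
   once the first block gets weight 1. *)
Lemma fractional_cover n s B L (H : {set {set 'I_n}}) :
  (0 < L)%N -> (B.+1 * L <= n)%N -> (n < B.+2 * L)%N ->
  shifted H -> uniform 4 H -> (matching_number H <= s)%N ->
  exists om : 'I_n -> rat, [/\ (forall v, 0 <= om v <= 1),
    (forall v v' : 'I_n, (v <= v')%N -> om v' <= om v),
    \sum_v om v <= (s + 1 + B.+1 ^ 4 + L)%:R &
    forall e, e \in H -> 1 <= \sum_(v in e) om v].
Proof.
move=> L0 BLn nBL sH /forall_inP uH nuH.
have [w [w0 sw] cov] := block_cover BLn L0 sH nuH.
pose mf (b : 'I_B.+1) := [arg min_(c < b | (c <= b)%N) w c]%O.
have mfP b : (mf b <= b)%N /\ forall c : 'I_B.+1, (c <= b)%N -> w (mf b) <= w c.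
  by rewrite /mf; case: arg_minP.
(* The shift by one turns the [B.+1] blocks of [w] into [B.+2], enough for the last, possibly
   incomplete block of vertices. *)
pose Om b : rat := if b is b'.+1 then Num.min 1 (w (mf (inord b'))) else 1.
have Om_ge0 b : 0 <= Om b by case: b => //= b; rewrite le_min ler01 w0.
have Om_le1 b : Om b <= 1 by case: b => //= b; rewrite ge_min lexx.
have divlt (v : 'I_n) : (v %/ L < B.+2)%N.
  by rewrite ltn_divLR //; exact: ltn_trans (ltn_ord v) nBL.
exists (fun v : 'I_n => Om (v %/ L)%N); split.
- by move=> v; rewrite Om_ge0 Om_le1.
- move=> v v' vv' /=; have := leq_div2r L vv'; have := divlt v'.
  case: (v %/ L)%N => [|c]; first by move=> _ _; exact: Om_le1.
  case: (v' %/ L)%N => [|c'] //; rewrite !ltnS => c'B cc' /=.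
  rewrite le_min !ge_min lexx /=; apply/orP; right.
  apply: (mfP _).2; apply: leq_trans (mfP _).1 _.
  by rewrite !inordK // ltnS (leq_trans cc').
- have -> : \sum_(v : 'I_n) Om (v %/ L)%N = \sum_(b : 'I_B.+2) \sum_(v : 'I_n | inord (v %/ L) == b) Om b.
    rewrite (partition_big (fun v : 'I_n => inord (v %/ L) : 'I_B.+2) xpredT) //=.
    apply: eq_bigr => b _; apply: eq_bigr => v /eqP <-; rewrite inordK //.
  apply: le_trans (_ : \sum_(b < B.+2) Om b * L%:R <= _).
    apply: ler_sum => b _; rewrite sumr_const -[_ *+ _]mulr_natr ler_wpM2l // ler_nat.
    rewrite -[L in leqRHS]card_ord.
    pose f (v : 'I_n) : 'I_L := Ordinal (ltn_pmod v L0).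
    rewrite -(card_in_imset (f := f)) ?max_card // => v v'; rewrite !unfold_in.
    move=> /eqP hv /eqP hv' /(congr1 val) /= E'; apply: val_inj => /=.
    have E : (v %/ L = v' %/ L)%N.
      by rewrite -[LHS](inordK (divlt v)) -[RHS](inordK (divlt v')) hv hv'.
    by rewrite (divn_eq v L) (divn_eq v' L) E E'.
  rewrite -mulr_suml big_ord_recl /= mulrDl mul1r [leRHS]natrD [leRHS]addrC lerD2l.
  apply: le_trans sw; rewrite ler_wpM2r //; apply: ler_sum => c _.
  rewrite ge_min; apply/orP; right; apply: (mfP _).2.
  by rewrite add0n inordK.
move=> e eH; have ce := eqP (uH e eH).
have [x xI xe] : exists2 x : {ffun 'I_4 -> 'I_n}, injective x & [set x j | j in 'I_4] = e.
  exists [ffun j => enum_val (cast_ord (esym ce) j)].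
    by move=> j j'; rewrite !ffunE => /enum_val_inj/cast_ord_inj.
  apply/setP => v; apply/imsetP/idP => [[j _ ->]|ve]; first by rewrite ffunE enum_valP.
  exists (cast_ord ce (enum_rank_in ve v)) => //.
  by rewrite ffunE cast_ordK enum_rankK_in.
rewrite -xe big_imset /=; last by move=> j j' _ _; exact: xI.
have one_term j : Om (x j %/ L)%N = 1 -> 1 <= \sum_(j in 'I_4) Om (x j %/ L)%N.
  by move=> E; rewrite (bigD1 j) //= E lerDl sumr_ge0.
(* A vertex of weight 1 covers its edge alone; otherwise no vertex is in block 0 and the truncation
   at 1 is inactive. *)
have [/existsP[j /eqP/one_term //]|/existsPn noone] := boolP [exists j, Om (x j %/ L)%N == 1].
pose c j := (x j %/ L).-1%N.
have xc j : (x j %/ L = (c j).+1)%N.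
  rewrite /c; case: (x j %/ L)%N (noone j) => //=; by rewrite eqxx.
have cB j : (c j < B.+1)%N by rewrite -ltnS -xc.
(* These blocks attain the running minima. As [a j <= c j], block [a j] ends before [x j], so [a] is
   a block edge. *)
pose a := [ffun j => mf (inord (c j))].
have aH : block_edge L H a.
  apply/existsP; exists x; rewrite xe eH /=; apply/andP; split; first exact/injectiveP.
  apply/forallP => j; rewrite ffunE; apply: leq_trans (leq_trunc_div (x j) L).
  rewrite leq_mul2r; apply/orP; right; rewrite xc ltnS.
  by apply: leq_trans (mfP _).1 _; rewrite inordK.
apply: le_trans (cov a aH) _; apply: ler_sum => j _; rewrite ffunE.
by have := noone j; rewrite xc /= minEle; case: ifP; rewrite ?eqxx.
Qed.

(** * The probabilistic inequality *)

(** In terms of [1 - p] the difference is a linear part plus a nonnegative square. Dropping the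
    square and bounding [1 - p] by [hr] leaves a quadratic in [u] whose minimum, near 11/16, is
    still large enough. *)
Lemma diagonal_vertex (R : realFieldType) (p u : R) : p <= 1 -> 1/2 <= u -> u <= 3/4 ->
  (1+33/10/10) <= p * (1/4 + 2 * u) ->
  (3 - 3/2 * p) * u * (p * (1/4 + 2*u)) + 1/10/10 <= (3 - 4*u) * p + 8*u - 4.
Proof.
move=> hp hu1 hu2 hq.
have hq4 : (1+33/10/10) <= 1/4 + 2 * u by nra.
have hr : 1 - p <= (1 + 13/25) * u - (1 - 19/10/10).
  have : (1 - p) * ((1+33/10/10)) <= (1 - p) * (1/4 + 2 * u) by apply: ler_wpM2l => //; lra.
  lra.
have e : (3 - 4*u) * p + 8*u - 4 - (3 - 3/2 * p) * u * (p * (1/4 + 2*u)) =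
   (4 * u - 1 - 3/2 * u * (1/4 + 2 * u)) - (3 - 4 * u) * (1 - p)
   + 3/2 * (u * (1/4 + 2 * u)) * (1 - p) ^+ 2 by field.
have h1 : (3 - 4 * u) * (1 - p) <= (3 - 4 * u) * ((1 + 13/25) * u - (1 - 19/10/10)).
  by apply: ler_wpM2l => //; lra.
have h2 : 0 <= 3/2 * (u * (1/4 + 2 * u)) * (1 - p) ^+ 2.
  apply: mulr_ge0; last exact: sqr_ge0.
  by apply: mulr_ge0; [lra | apply: mulr_ge0; lra].
have h3 : 0 <= (u - 11/16) ^+ 2 by exact: sqr_ge0.
nra.
Qed.

Lemma top_vertex (R : realFieldType) (p u : R) : p <= 1 -> 1/2 <= u -> u <= 3/4 ->
  (1+33/10/10) <= p * (1/4 + 2 * u) ->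
  4 * (p * (1/4 + 2*u) - 1) * (3 - 3*u - 3/2 * p * u) + 1/50 <= (3 - 4*u) * p.
Proof.
move=> hp hu1 hu2 hq.
have hq4 : (1+33/10/10) <= 1/4 + 2 * u by nra.
have hr : 1 - p <= (1 + 13/25) * u - (1 - 19/10/10).
  have : (1 - p) * ((1+33/10/10)) <= (1 - p) * (1/4 + 2 * u) by apply: ler_wpM2l => //; lra.
  lra.
have hr2 : 1 - p <= 243/10/10/10.
  have : p * (1/4 + 2 * u) <= p * (7/4) by apply: ler_wpM2l; lra.
  lra.
have e : (3 - 4*u) * p - 4 * (p * (1/4 + 2*u) - 1) * (3 - 3*u - 3/2 * p * u) =
  36 * u ^+ 2 - (41+1/2) * u + 12 + (28 * u - 48 * u ^+ 2) * (1 - p)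
   + 6 * (u * (1/4 + 2 * u)) * (1 - p) ^+ 2 by field.
have huq : 0 <= 6 * (u * (1/4 + 2 * u)).
  by apply: mulr_ge0; [lra | apply: mulr_ge0; lra].
(* Here the square cannot simply be dropped; it is replaced by its tangent at [r0]. The values of
   [r0] used below grow with [u], as do the bounds on [1 - p]. *)
have hsq r0 : 0 <= 6 * (u * (1/4 + 2 * u)) * (1 - p - r0) ^+ 2.
  by apply: mulr_ge0 => //; exact: sqr_ge0.
have hp0 : 0 <= 1 - p by lra.
set r := 1 - p in hr hr2 e hsq hp0 *.
have [u1|u1] := lerP u (3/5).
  have := hsq 0; have := sqr_ge0 (u - (4/7)); have : 0 <= r * (3/5 - u) by nra.
  nra.
have [u2|u2] := lerP u (16/25).
  have := hsq (1/10); have := sqr_ge0 (u - (4/7)).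
  nra.
have [u3|u3] := lerP u (17/25).
  have := hsq (4/25); nra.
have := hsq (6/25); have := sqr_ge0 (u - 11/16); nra.
Qed.

(* For fixed [p] and [u] the constraints on [(y, h)] cut out a polygon, on which the
   left-hand side of the last hypothesis is smallest at the vertex with [y = h] or at
   the one with [h] maximal; [diagonal_vertex] and [top_vertex] exclude these, with
   room for the perturbations by small constants. *)
Lemma polygon_infeasible (R : realFieldType) (p u y h : R) :
  0 <= p -> p <= 1 -> 0 <= u -> u <= 3/4 -> 0 <= y -> y <= h -> h <= (3/4 * ((1 + 1/10/10/10))) ->
  1 - h - 1/8/10/10 <= y * (p * (1/4 + 2 * u) - 1) ->
  (1/2 <= u -> (3 - 4 * u) * p * y + 4 * (2 * u - 1) * h
     <= 3 * u - 3/2 * p * u + 3/10/10/10) -> False.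
Proof.
move=> p0 p1 u0 u1 y0 yh h1 hA hC.
set Q := p * (1/4 + 2 * u) in hA.
have hQ : Q <= 7/4.
  have : Q <= 1 * (1/4 + 2 * u) by apply: ler_wpM2r => //; lra.
  lra.
have Q1 : 1 < Q.
  rewrite ltNge; apply/negP => Q1.
  have : y * (Q - 1) <= 0 by apply: mulr_ge0_le0 => //; lra.
  lra.
have hhQ : y * (Q - 1) <= h * (Q - 1) by apply: ler_wpM2r => //; lra.
have Q2 : (1+33/10/10) <= Q.
  have : h * Q <= (3/4 * ((1 + 1/10/10/10))) * Q by apply: ler_wpM2r => //; lra.
  lra.
have u2 : 1/2 <= u.
  have : Q <= 1 * (1/4 + 2 * u) by apply: ler_wpM2r => //; lra.
  lra.
have {}hC := hC u2.
have := diagonal_vertex p1 u2 u1 Q2; have := top_vertex p1 u2 u1 Q2; rewrite -/Q => v2 v1.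
set alpha := (3 - 4 * u) * p in hC v1 v2.
set beta := 4 * (2 * u - 1) in hC.
have a0 : 0 <= alpha by apply: mulr_ge0 => //; lra.
have a1 : alpha <= 1.
  have : alpha <= (3 - 4 * u) * 1 by apply: ler_wpM2l => //; lra.
  lra.
have b0 : 0 <= beta by rewrite /beta; lra.
have b1 : beta <= 2 by rewrite /beta; lra.
have hay : alpha * (1 - h - 1/8/10/10) <= alpha * (y * (Q - 1)) by apply: ler_wpM2l.
have hCQ k : 0 <= k -> k * (alpha * y + beta * h) <= k * (3 * u - 3/2 * p * u + 3/10/10/10).
  by move=> k0; apply: ler_wpM2l.
(* On the line where [hA] is tight, the objective changes with [h] at the rate
   [beta - alpha / (Q - 1)]; its sign selects the minimizing vertex. *)
have [cas|cas] := lerP (beta * (Q - 1)) alpha.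
  have hh : (alpha - beta * (Q - 1)) * h <= (alpha - beta * (Q - 1)) * ((3/4 * ((1 + 1/10/10/10)))).
    by apply: ler_wpM2l => //; lra.
  have hbQ : 0 <= (8 * u - 4) * (Q - 1) by apply: mulr_ge0; lra.
  have := hCQ (Q - 1) ltac:(lra).
  rewrite /beta in hh *.
  move: v2 hh hay hbQ; clear -hQ Q1 a0 a1 u1 u2; clearbody alpha Q.
  lra.
have hh : (beta * (Q - 1) - alpha) * y <= (beta * (Q - 1) - alpha) * h.
  by apply: ler_wpM2l => //; lra.
have hby : (alpha + beta) * (1 - h - 1/8/10/10) <= (alpha + beta) * (y * (Q - 1)).
  by apply: ler_wpM2l => //; lra.
have := hCQ Q ltac:(lra).
have := v1; rewrite /beta in hh hby b1 b0 *.
move: hh hby; clear -hQ Q1 a0 a1 b1 b0 u1 u2 p0 p1; move: Q alpha hQ Q1 a0 a1 => Q al.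
nra.
Qed.

(* The quantities of [five_variables]: [a = E U], [t = 4 E X / E U],
   [e = P(X_2 + X_3 < U - (1 - u))], [d = P(X_1 + X_2 + X_3 >= u)],
   [x = P(X_1 + ... + X_4 >= 1) / t] and [L = P(X_1 + X_2 + X_3 < U)].  The
   substitution is [p = a / u], [y = x u / a^2], [h] close to [3 (1 - e) / 4]. *)
Lemma core_inequality (R : realFieldType) (a u t e d x L : R) :
  0 < a -> a <= u -> u <= 3/4 -> 0 < t -> t <= (1 + 1/10/10/10) ->
  0 <= e -> 0 <= d -> 0 <= x ->
  a - 3/4 * t * a * (1 - e) + d * (u - a) + t * x * (3/4 - u) <= u * L ->
  x <= a * d ->
  u * d <= 3/4 * t * a * (1 - e) ->
  (1/2 <= u ->
   (3 - 4 * u) * (1 - L) <= 3 * (t * a / 2 - a + 1 - u + (2 * u - 1) * e)) ->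
  d <= 1 - L ->
  (1 + 2/10/10/10) * x <= L.
Proof.
move=> a0 au u1 t0 t1 e0 d0 x0 H1 H2 H3 H4 H5.
rewrite leNgt; apply/negP => HL.
have u0 : 0 < u by lra.
pose p := a / u; pose y := x * u / a ^+ 2.
have ae : a = p * u by rewrite /p; field; lra.
have p0 : 0 < p by rewrite /p divr_gt0.
have p1 : p <= 1 by rewrite /p ler_pdivrMr // mul1r.
have xe : x = p ^+ 2 * u * y by rewrite /p /y; field; rewrite !gt_eqF.
have y0 : 0 <= y by rewrite /y divr_ge0 ?exprn_ge0 ?mulr_ge0 // ltW.
have pu0 : 0 < p * u by rewrite mulr_gt0.
have dpy : p * y <= d.
  have : p * u * (p * y) <= p * u * d by move: H2; rewrite xe ae; lra.
  by rewrite ler_pM2l.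
set g := 1 - e in H1 H3.
have g1 : g <= 1 by rewrite /g; lra.
have yg : y <= 3/4 * t * g.
  have h : u * (p * y) <= u * d by apply: ler_wpM2l => //; lra.
  have : p * u * y <= p * u * (3/4 * t * g) by move: H3 h; rewrite ae; lra.
  by rewrite ler_pM2l.
have g0 : 0 <= g.
  have : 0 <= t * g by lra.
  by rewrite pmulr_rge0.
pose T : R := (1 + 1/10/10/10).
have gT : t * g <= T * g by apply: ler_wpM2r.
apply: (@polygon_infeasible R p u y (3/4 * T * g)); rewrite /T in gT *; try lra.
(* [H1] combined with [HL] and divided by [p * u] gives the first polygon constraint; the small
   constants absorb [t - 1]. *)
- have h1 : p * u * (3/4 * t * g) = 3/4 * t * a * g by rewrite ae; lra.
  have h2 : p * y * (u - a) <= d * (u - a) by apply: ler_wpM2r => //; lra.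
  have h3 : u * L < u * ((1 + 2/10/10/10) * x) by rewrite ltr_pM2l.
  have h4 : p * u * (1 - 3/4 * t * g + y * (1 - p) + t * p * y * (3/4 - u))
     < p * u * ((1 + 2/10/10/10) * p * u * y).
    have : a - 3/4 * t * a * g + p * y * (u - a) + t * x * (3/4 - u)
       < u * ((1 + 2/10/10/10) * x) by lra.
    by rewrite xe ae; lra.
  move: h4; rewrite ltr_pM2l // => h4.
  have py1 : p * y <= y by rewrite -[leRHS]mul1r; apply: ler_wpM2r.
  have py0 : 0 <= p * y by apply: mulr_ge0 => //; exact: ltW.
  have h5 : p * y * (3/4 - u) <= p * y * (3/4) by apply: ler_wpM2l => //; lra.
  have h6 : ((1 + 1/10/10/10) - t) * (p * y * (3/4 - u)) <= ((1 + 1/10/10/10) - t) * (3/4 * g).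
    by apply: ler_wpM2l; lra.
  have h7 : p * y * u <= p * y * (3/4) by apply: ler_wpM2l => //; lra.
  lra.
- move=> u2; have {}H4 := H4 u2.
  have h1 : (3 - 4 * u) * (p * y) <= (3 - 4 * u) * (1 - L).
    by apply: ler_wpM2l => //; lra.
  have h2 : t * a <= (1 + 1/10/10/10) * a by apply: ler_wpM2r => //; lra.
  have h3 : (2 * u - 1) * g <= (2 * u - 1) * 1 by apply: ler_wpM2l => //; lra.
  have ee : e = 1 - g by rewrite /g; lra.
  move: H4 h2; rewrite ee ae; lra.
Qed.

Definition avg (R : realFieldType) (T : finType) (f : T -> R) : R :=
  (\sum_x f x) / #|T|%:R.

Section Average.
Variable R : realFieldType.
Implicit Types T A B : finType.

Lemma eq_avg T (f g : T -> R) : f =1 g -> avg f = avg g.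
Proof. by move=> fg; rewrite /avg (eq_bigr g). Qed.

Lemma ler_avg T (f g : T -> R) : (forall x, f x <= g x) -> avg f <= avg g.
Proof. by move=> fg; rewrite /avg ler_wpM2r ?invr_ge0 ?ler0n // ler_sum. Qed.

Lemma avg_ge0 T (f : T -> R) : (forall x, 0 <= f x) -> 0 <= avg f.
Proof. by move=> f0; rewrite /avg divr_ge0 ?ler0n // sumr_ge0. Qed.

Lemma avgD T (f g : T -> R) : avg (fun x => f x + g x) = avg f + avg g.
Proof. by rewrite /avg big_split mulrDl. Qed.

Lemma avgN T (f : T -> R) : avg (fun x => - f x) = - avg f.
Proof. by rewrite /avg sumrN mulNr. Qed.

Lemma avgB T (f g : T -> R) : avg (fun x => f x - g x) = avg f - avg g.
Proof. by rewrite avgD avgN. Qed.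

Lemma avgZ T (c : R) (f : T -> R) : avg (fun x => c * f x) = c * avg f.
Proof. by rewrite /avg -mulr_sumr mulrA. Qed.

Lemma avg_cst T (c : R) : (0 < #|T|)%N -> avg (fun _ : T => c) = c.
Proof. by move=> T0; rewrite /avg sumr_const -[c *+ _]mulr_natr mulfK // pnatr_eq0 -lt0n. Qed.

Lemma avg_bij A B (phi : A -> B) (f : B -> R) :
  bijective phi -> avg (fun x => f (phi x)) = avg f.
Proof.
move=> bphi; rewrite /avg (bij_eq_card bphi); congr (_ / _).
by rewrite [RHS](reindex phi) //; exact: onW_bij.
Qed.

Lemma avg_pair A B (f : A -> R) (g : B -> R) :
  avg (fun p : A * B => f p.1 * g p.2) = avg f * avg g.
Proof.
rewrite /avg mulrACA -(pair_bigA _ (fun x y => f x * g y)) /=.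
rewrite big_distrlr /= card_prod natrM invfM; congr (_ * _).
Qed.

(** Independence is expressed by a bijection of the sample space with a product whose factors carry
    [f] and [g]. *)
Lemma avg_indep T A B (phi : T -> A * B) (f : A -> R) (g : B -> R) :
  bijective phi -> avg (fun x => f (phi x).1 * g (phi x).2) = avg f * avg g.
Proof.
by move=> bphi; rewrite -avg_pair (avg_bij (fun p : A * B => f p.1 * g p.2) bphi).
Qed.

Lemma avg_proj T A B (phi : T -> A * B) (f : A -> R) :
  (0 < #|B|)%N -> bijective phi -> avg (fun x => f (phi x).1) = avg f.
Proof.
move=> B0 bphi; rewrite -[RHS]mulr1 -(avg_cst (T := B) 1 B0) -(avg_indep f _ bphi).
by apply: eq_avg => x; rewrite mulr1.
Qed.

Lemma avg_indep_r T A B (phi : T -> A * B) (f : A -> R) (g : B -> R) :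
  (0 < #|A|)%N -> bijective phi ->
  avg (fun x => f (phi x).1 * g (phi x).2) = avg f * avg (fun x => g (phi x).2).
Proof.
move=> A0 bphi; rewrite avg_indep //; congr (_ * _).
rewrite -[LHS]mul1r -(avg_cst (T := A) 1 A0) -(avg_indep _ g bphi).
by apply: eq_avg => x; rewrite mul1r.
Qed.

End Average.

Section FiveVariables.
Variables (R : realFieldType) (C S : finType) (X : C -> R) (U : S -> R).
Variables (u mu a : R).
Hypotheses (C0 : (0 < #|C|)%N) (S0 : (0 < #|S|)%N).
Hypotheses (X0 : forall c, 0 <= X c) (Xu : forall c, X c <= 1 - u).
Hypotheses (U0 : forall i, 0 <= U i) (Uu : forall i, U i <= u).
Hypotheses (Emu : avg X = mu) (Ea : avg U = a).

Local Notation Om := (C * C * C * C * S)%type.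
Let x1 (o : Om) := X o.1.1.1.1.
Let x2 (o : Om) := X o.1.1.1.2.
Let x3 (o : Om) := X o.1.1.2.
Let x4 (o : Om) := X o.1.2.
Let v (o : Om) := U o.2.

(** The maps [sw] exchange the first coordinate with another and express exchangeability; the maps
    [out] split off one coordinate as an independent factor. *)
Let sw12 (o : Om) : Om := (o.1.1.1.2, o.1.1.1.1, o.1.1.2, o.1.2, o.2).
Let sw13 (o : Om) : Om := (o.1.1.2, o.1.1.1.2, o.1.1.1.1, o.1.2, o.2).
Let sw14 (o : Om) : Om := (o.1.2, o.1.1.1.2, o.1.1.2, o.1.1.1.1, o.2).
Let out1 (o : Om) : C * (C * C * C * S) := (o.1.1.1.1, (o.1.1.1.2, o.1.1.2, o.1.2, o.2)).
Let out4 (o : Om) : C * (C * C * C * S) := (o.1.2, (o.1.1.1.1, o.1.1.1.2, o.1.1.2, o.2)).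
Let out5 (o : Om) : S * (C * C * C * C) := (o.2, o.1).

Let bij12 : bijective sw12. Proof. by exists sw12; do 4![case=> //]. Qed.
Let bij13 : bijective sw13. Proof. by exists sw13; do 4![case=> //]. Qed.
Let bij14 : bijective sw14. Proof. by exists sw14; do 4![case=> //]. Qed.
Let bijo1 : bijective out1.
Proof.
by exists (fun p => (p.1, p.2.1.1.1, p.2.1.1.2, p.2.1.2, p.2.2)); [do 4![case=> //]| case=> ? [[[]]]].
Qed.
Let bijo4 : bijective out4.
Proof.
by exists (fun p => (p.2.1.1.1, p.2.1.1.2, p.2.1.2, p.1, p.2.2)); [do 4![case=> //]| case=> ? [[[]]]].
Qed.
Let bijo5 : bijective out5.
Proof. by exists (fun p => (p.2, p.1)); case. Qed.

Let CCCS0 : (0 < #|{: C * C * C * S}|)%N.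
Proof. by rewrite !card_prod !muln_gt0 C0 S0. Qed.
Let CCCC0 : (0 < #|{: C * C * C * C}|)%N.
Proof. by rewrite !card_prod !muln_gt0 C0. Qed.
Let Om0 : (0 < #|{: Om}|)%N.
Proof. by rewrite !card_prod !muln_gt0 C0 S0. Qed.

Let Ex1 : avg x1 = mu.
Proof. by rewrite -Emu -(avg_proj X CCCS0 bijo1). Qed.
Let Ex2 : avg x2 = mu. Proof. by rewrite -Ex1 -(avg_bij x1 bij12). Qed.
Let Ex3 : avg x3 = mu. Proof. by rewrite -Ex1 -(avg_bij x1 bij13). Qed.
Let Ev : avg v = a.
Proof. by rewrite -Ea -(avg_proj U CCCC0 bijo5). Qed.

Let z o := x1 o + x2 o + x3 o.

Let L := avg (fun o => (z o < v o)%R%:R : R).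
Let d := avg (fun o => (u <= z o)%R%:R : R).
Let e := avg (fun o => (x2 o + x3 o < v o - (1 - u))%R%:R : R).
Let f := avg (fun o => (1 <= z o + x4 o)%R%:R : R).

Let m3 := avg (fun o => x1 o * (v o <= z o)%R%:R).
Let m3u := avg (fun o => x1 o * (u <= z o)%R%:R).
Let m4 := avg (fun o => x1 o * (1 <= z o + x4 o)%R%:R).

Let m3_2 : avg (fun o => x2 o * (v o <= z o)%R%:R) = m3.
Proof.
rewrite /m3 -[RHS](avg_bij _ bij12); apply: eq_avg => o; congr (_ * (_ <= _)%R%:R).
by rewrite /z /x1 /x2 /x3 /=; ring.
Qed.
Let m3_3 : avg (fun o => x3 o * (v o <= z o)%R%:R) = m3.
Proof.
rewrite /m3 -[RHS](avg_bij _ bij13); apply: eq_avg => o; congr (_ * (_ <= _)%R%:R).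
by rewrite /z /x1 /x2 /x3 /=; ring.
Qed.
Let m3u_2 : avg (fun o => x2 o * (u <= z o)%R%:R) = m3u.
Proof.
rewrite /m3u -[RHS](avg_bij _ bij12); apply: eq_avg => o; congr (_ * (_ <= _)%R%:R).
by rewrite /z /x1 /x2 /x3 /=; ring.
Qed.
Let m3u_3 : avg (fun o => x3 o * (u <= z o)%R%:R) = m3u.
Proof.
rewrite /m3u -[RHS](avg_bij _ bij13); apply: eq_avg => o; congr (_ * (_ <= _)%R%:R).
by rewrite /z /x1 /x2 /x3 /=; ring.
Qed.
Let m4_2 : avg (fun o => x2 o * (1 <= z o + x4 o)%R%:R) = m4.
Proof.
rewrite /m4 -[RHS](avg_bij _ bij12); apply: eq_avg => o; congr (_ * (_ <= _)%R%:R).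
by rewrite /z /x1 /x2 /x3 /x4 /=; ring.
Qed.
Let m4_3 : avg (fun o => x3 o * (1 <= z o + x4 o)%R%:R) = m4.
Proof.
rewrite /m4 -[RHS](avg_bij _ bij13); apply: eq_avg => o; congr (_ * (_ <= _)%R%:R).
by rewrite /z /x1 /x2 /x3 /x4 /=; ring.
Qed.
Let m4_4 : avg (fun o => x4 o * (1 <= z o + x4 o)%R%:R) = m4.
Proof.
rewrite /m4 -[RHS](avg_bij _ bij14); apply: eq_avg => o; congr (_ * (_ <= _)%R%:R).
by rewrite /z /x1 /x2 /x3 /x4 /=; ring.
Qed.

Let eC : avg (fun o => (v o - (1 - u) <= x2 o + x3 o)%R%:R : R) = 1 - e.
Proof.
transitivity (avg (fun _ : Om => 1) - e); last by rewrite avg_cst.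
rewrite -avgB; apply: eq_avg => o.
by case: ltrP => _; rewrite ?subr0 ?subrr.
Qed.

(* Size bias: as [x1 <= 1 - u], deleting [x1] from [v <= x1 + x2 + x3] leaves an
   event independent of [x1]. *)
Let m3_le : m3 <= mu * (1 - e).
Proof.
have -> : mu * (1 - e) = avg (fun o => x1 o * (v o - (1 - u) <= x2 o + x3 o)%R%:R).
  rewrite -eC -Emu; symmetry.
  exact: (avg_indep_r X (fun r : C * C * C * S =>
    (U r.2 - (1 - u) <= X r.1.1.1 + X r.1.1.2)%R%:R) C0 bijo1).
rewrite /m3; apply: ler_avg => o; apply: ler_wpM2l; first exact: X0.
rewrite ler_nat; have := Xu o.1.1.1.1; rewrite -/(x1 o) => h.
by case: (lerP (v o) (z o)) => // h2; case: lerP => // h3; move: h2; rewrite /z; lra.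
Qed.

Let m3u_le : m3u <= mu * (1 - e).
Proof.
apply: le_trans m3_le.
rewrite /m3 /m3u; apply: ler_avg => o; apply: ler_wpM2l; first exact: X0.
have := Uu o.2; rewrite -/(v o) ler_nat => h.
by case: (lerP u (z o)) => // h2; case: lerP => // h3; lra.
Qed.

Let m4_le : m4 <= mu * d.
Proof.
have -> : mu * d = avg (fun o => x4 o * (u <= z o)%R%:R).
  rewrite -Emu; symmetry.
  exact: (avg_indep_r X (fun r : C * C * C * S =>
    (u <= X r.1.1.1 + X r.1.1.2 + X r.1.2)%R%:R) C0 bijo4).
rewrite -m4_4; apply: ler_avg => o; apply: ler_wpM2l; first exact: X0.
rewrite ler_nat; have := Xu o.1.2; rewrite -/(x4 o) => h.
by case: (lerP 1 (z o + x4 o)) => // h2; case: lerP => // h3; lra.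
Qed.

Let vd : avg (fun o => v o * (u <= z o)%R%:R) = a * d.
Proof.
rewrite -Ea.
exact: (avg_indep_r U (fun r : C * C * C * C =>
  (u <= X r.1.1.1 + X r.1.1.2 + X r.1.2)%R%:R) S0 bijo5).
Qed.

Let d_le : d <= 1 - L.
Proof.
suff : d + L <= 1 by lra.
rewrite -[leRHS](avg_cst (T := Om) 1 Om0) -avgD; apply: ler_avg => o.
have := Uu o.2; rewrite -/(v o) => h.
by case: (lerP u (z o)) => h1; case: ltrP => h2; rewrite ?addr0 ?add0r //; lra.
Qed.

(** Pointwise, [v <= u] handles [z < v]. Where [v <= z] the contribution [v - z] is nonpositive; it
    is raised to [u - z] if [u <= z], and to 0 if the four weights reach 1, an event that forces
    [u <= z] because [x4 <= 1 - u]. *)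
Let H1 : a - 3 * m3 + u * d - a * d + (3 * m4 - u * f) <= u * L.
Proof.
suff : avg (fun o => v o + - (x1 o * (v o <= z o)%R%:R) + - (x2 o * (v o <= z o)%R%:R)
   + - (x3 o * (v o <= z o)%R%:R) + u * (u <= z o)%R%:R + - (v o * (u <= z o)%R%:R)
   + x1 o * (1 <= z o + x4 o)%R%:R + x2 o * (1 <= z o + x4 o)%R%:R
   + x3 o * (1 <= z o + x4 o)%R%:R + - (u * (1 <= z o + x4 o)%R%:R))
   <= avg (fun o => u * (z o < v o)%R%:R).
  rewrite !avgD !avgN !avgZ m3_2 m3_3 m4_2 m4_3 vd Ev -/m3 -/m4 -/d -/f -/L; lra.
apply: ler_avg => o.
have := Uu o.2; rewrite -/(v o) => h1.
have := Xu o.1.2; rewrite -/(x4 o) => h4.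
have [vz|vz] := lerP (v o) (z o); have [uz|uz] := lerP u (z o);
  have [F|F] := lerP 1 (z o + x4 o); rewrite /= /z in vz uz F * ; lra.
Qed.

Let f_le : f <= 4 * m4.
Proof.
suff : f <= avg (fun o => x1 o * (1 <= z o + x4 o)%R%:R + x2 o * (1 <= z o + x4 o)%R%:R
   + x3 o * (1 <= z o + x4 o)%R%:R + x4 o * (1 <= z o + x4 o)%R%:R).
  rewrite !avgD m4_2 m4_3 m4_4 -/m4; lra.
apply: ler_avg => o; have [F|F] := lerP 1 (z o + x4 o); rewrite /= /z in F *; lra.
Qed.

Let H3 : u * d <= 3 * m3u.
Proof.
suff : avg (fun o => u * (u <= z o)%R%:R) <= avg (fun o => x1 o * (u <= z o)%R%:R
   + x2 o * (u <= z o)%R%:R + x3 o * (u <= z o)%R%:R).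
  rewrite !avgD avgZ m3u_2 m3u_3 -/m3u -/d; lra.
apply: ler_avg => o; have [F|F] := lerP u (z o); rewrite /= /z in F *; lra.
Qed.

Let e13 : avg (fun o => (x1 o + x3 o < v o - (1 - u))%R%:R : R) = e.
Proof.
rewrite /e -[RHS](avg_bij _ bij12); apply: eq_avg => o.
by rewrite /x1 /x2 /x3.
Qed.

Let e12 : avg (fun o => (x1 o + x2 o < v o - (1 - u))%R%:R : R) = e.
Proof.
rewrite /e -[RHS](avg_bij _ bij13); apply: eq_avg => o.
by rewrite /x1 /x2 /x3 /= addrC.
Qed.

(** Markov's inequality for the sum over the three pairs of [xi + xj - (v - (1 - u))], plus
    [2 * u - 1] when this is negative; each summand is nonnegative as [v <= u]. If [v <= z], no pair
    is negative and the sum is [2 * z - 3 * v + 3 * (1 - u)], at least [3 - 4 * u]. *)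
Let H4 : 1/2 <= u -> u <= 3/4 ->
  (3 - 4 * u) * (1 - L) <= 3 * (2 * mu - a + 1 - u + (2 * u - 1) * e).
Proof.
move=> u1 u2.
suff : avg (fun o => (3 - 4 * u) + - ((3 - 4 * u) * (z o < v o)%R%:R)) <=
  avg (fun o => 2 * x1 o + 2 * x2 o + 2 * x3 o + - (3 * v o) + 3 * (1 - u)
    + (2 * u - 1) * (x1 o + x2 o < v o - (1 - u))%R%:R
    + (2 * u - 1) * (x1 o + x3 o < v o - (1 - u))%R%:R
    + (2 * u - 1) * (x2 o + x3 o < v o - (1 - u))%R%:R).
  rewrite !avgD !avgN !avgZ !avg_cst // e12 e13 Ex1 Ex2 Ex3 Ev -/L -/e; lra.
apply: ler_avg => o.
have := Uu o.2; rewrite -/(v o) => h1.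
have := U0 o.2; rewrite -/(v o) => h0.
have := X0 o.1.1.1.1; rewrite -/(x1 o) => p1.
have := X0 o.1.1.1.2; rewrite -/(x2 o) => p2.
have := X0 o.1.1.2; rewrite -/(x3 o) => p3.
have := Xu o.1.1.1.1; rewrite -/(x1 o) => q1.
have := Xu o.1.1.1.2; rewrite -/(x2 o) => q2.
have := Xu o.1.1.2; rewrite -/(x3 o) => q3.
case: (ltrP (x1 o + x2 o)) => h12; case: (ltrP (x1 o + x3 o)) => h13;
 case: (ltrP (x2 o + x3 o)) => h23; case: ltrP => hz; rewrite /= /z in hz *; lra.
Qed.

Lemma five_variables t :
  0 < a -> 0 < t -> t <= 1 + 1/10/10/10 -> 4 * mu = t * a ->
  (1 + 2/10/10/10) * f <= t * L.
Proof.
move=> a0 t0 t1 mut.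
have au : a <= u.
  by rewrite -Ev -[leRHS](avg_cst (T := Om) u Om0); apply: ler_avg => o; exact: Uu.
have L0 : 0 <= L by apply: avg_ge0 => o; exact: ler0n.
have d0 : 0 <= d by apply: avg_ge0 => o; exact: ler0n.
have e0 : 0 <= e by apply: avg_ge0 => o; exact: ler0n.
have f0 : 0 <= f by apply: avg_ge0 => o; exact: ler0n.
have tL0 : 0 <= t * L by apply: mulr_ge0 => //; exact: ltW.
(* For [u > 3/4] all four weights are below 1/4 and cannot sum to 1. *)
have [u1|u1] := lerP u (3/4); last first.
  suff -> : f = 0 by rewrite mulr0.
  rewrite /f -[RHS](avg_cst (T := Om) 0 Om0); apply: eq_avg => o.
  have := Xu o.1.1.1.1; rewrite -/(x1 o) => q1.
  have := Xu o.1.1.1.2; rewrite -/(x2 o) => q2.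
  have := Xu o.1.1.2; rewrite -/(x3 o) => q3.
  have := Xu o.1.2; rewrite -/(x4 o) => q4.
  by case: lerP => // h; rewrite /z in h; lra.
have mue : mu = t * a / 4 by lra.
have hf : f / t * t = f by rewrite divfK // gt_eqF.
have : (1 + 2/10/10/10) * (f / t) <= L.
  apply: (@core_inequality R a u t e d (f / t) L) => //.
  - by rewrite divr_ge0 // ltW.
  - have -> : t * (f / t) * (3/4 - u) = f * (3/4 - u) by rewrite (mulrC t) hf.
    move: m3_le; rewrite mue; move: H1 f_le; lra.
  - rewrite ler_pdivrMr //; apply: le_trans f_le _.
    move: m4_le; rewrite mue; lra.
  - apply: le_trans H3 _; move: m3u_le; rewrite mue; lra.
  - by move=> u2; apply: le_trans (H4 u2 u1) _; rewrite mue; lra.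
move=> h; rewrite -hf mulrA mulrC; apply: ler_wpM2l => //; exact: ltW.
Qed.

(** This crude bound later keeps the weight outside the first [s] vertices of order [s]. *)
Lemma five_variables_markov : f <= 4 * mu.
Proof.
apply: le_trans f_le _; rewrite ler_pM2l //; apply: le_trans m4_le _.
have mu0 : 0 <= mu by rewrite -Emu; exact: avg_ge0.
rewrite ler_piMr //; have := d_le; have : 0 <= L by apply: avg_ge0 => o; exact: ler0n.
lra.
Qed.

End FiveVariables.

Lemma avg_card (R : realFieldType) (T : finType) (b : pred T) :
  avg (fun x => (b x)%:R) = #|b|%:R / #|T|%:R :> R.
Proof.
rewrite /avg -sum1_card natr_sum [in RHS]big_mkcond; congr (_ / _).
by apply: eq_bigr => x _; rewrite unfold_in; case: (b x).
Qed.

Section Counting.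
Variables (R : realFieldType) (C S : finType) (X : C -> R) (U : S -> R) (u : R).
Hypotheses (C0 : (0 < #|C|)%N) (S0 : (0 < #|S|)%N).
Hypotheses (X0 : forall c, 0 <= X c) (Xu : forall c, X c <= 1 - u).
Hypotheses (U0 : forall i, 0 <= U i) (Uu : forall i, U i <= u).

(** For [X] the cover weights outside the first [s] vertices and [U] the complements to 1 inside,
    ordered inner edges are heavy, and a light quadruple has total weight below 1, too little for an
    edge. *)
Definition heavy_quadruple : pred (C * C * C * C) :=
  fun p => 1 <= X p.1.1.1 + X p.1.1.2 + X p.1.2 + X p.2.
Definition light_quadruple : pred (C * C * C * S) :=
  fun p => X p.1.1.1 + X p.1.1.2 + X p.1.2 < U p.2.

Let N : R := #|C|%:R.
Let m : R := #|S|%:R.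
Let N0 : 0 < N. Proof. by rewrite ltr0n. Qed.
Let m0 : 0 < m. Proof. by rewrite ltr0n. Qed.

Let avg_heavy : avg (fun o : C * C * C * C * S =>
    (1 <= X o.1.1.1.1 + X o.1.1.1.2 + X o.1.1.2 + X o.1.2)%R%:R)
  = #|heavy_quadruple|%:R / N ^+ 4 :> R.
Proof.
have bid : bijective (fun o : C * C * C * C * S => o) by exists id.
rewrite (avg_proj (fun p => (heavy_quadruple p)%:R) S0 bid) avg_card.
by rewrite !card_prod !natrM; congr (_ / _); rewrite /N; ring.
Qed.

Let avg_light : avg (fun o : C * C * C * C * S =>
    (X o.1.1.1.1 + X o.1.1.1.2 + X o.1.1.2 < U o.2)%R%:R)
  = #|light_quadruple|%:R / (N ^+ 3 * m) :> R.
Proof.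
pose phi (o : C * C * C * C * S) := ((o.1.1, o.2), o.1.2).
have bphi : bijective phi.
  by exists (fun p : C * C * C * S * C => ((p.1.1, p.2), p.1.2)); do 2![case=> //].
rewrite (avg_proj (fun p => (light_quadruple p)%:R) C0 bphi) avg_card.
by rewrite !card_prod !natrM; congr (_ / _); rewrite /N; ring.
Qed.

Lemma heavy_count : #|heavy_quadruple|%:R <= 4 * N ^+ 3 * \sum_c X c.
Proof.
have := five_variables_markov C0 S0 X0 Xu Uu (erefl _); rewrite /= avg_heavy /avg -/N.
rewrite ler_pdivrMr ?exprn_gt0 //; congr (_ <= _).
by field; rewrite gt_eqF.
Qed.

Lemma heavy_light_count : 0 < \sum_i U i -> 0 < \sum_c X c ->
  4 * (\sum_c X c) * m <= (1 + 1/10/10/10) * (\sum_i U i) * N ->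
  (1 + 2/10/10/10) * #|heavy_quadruple|%:R * (\sum_i U i)
    <= 4 * (\sum_c X c) * #|light_quadruple|%:R.
Proof.
set A := \sum_i U i; set W := \sum_c X c => A0 W0 hWA.
pose t := 4 * W * m / (A * N).
have AN0 : 0 < A * N by rewrite mulr_gt0.
have t0 : 0 < t by rewrite divr_gt0 // !mulr_gt0.
have t1 : t <= 1 + 1/10/10/10 by rewrite ler_pdivrMr // mulrA.
have aE : avg U = A / m by [].
have muE : avg X = W / N by [].
have a0 : 0 < A / m by rewrite divr_gt0.
have mut : 4 * (W / N) = t * (A / m).
  by rewrite /t; field; rewrite !gt_eqF.
have := five_variables C0 S0 X0 Xu U0 Uu muE aE a0 t0 t1 mut.
rewrite /= avg_heavy avg_light.
have -> : t * (#|light_quadruple|%:R / (N ^+ 3 * m))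
    = 4 * W * #|light_quadruple|%:R / A / N ^+ 4.
  by rewrite /t; field; rewrite !gt_eqF.
by rewrite mulrA ler_pM2r ?invr_gt0 ?exprn_gt0 // ler_pdivlMr.
Qed.

End Counting.

(** * The sparse case *)

Lemma card_val_preimset (T : finType) (A : {set T}) (G : {set {set T}}) :
  (forall e, e \in G -> e \subset A) ->
  #|[set B : {set {x | x \in A}} | [set val x | x in B] \in G]| = #|G|.
Proof.
move=> GA; rewrite -(card_imset _ (imset_inj (@val_inj _ _ {x | x \in A}))).
apply: eq_card => e; apply/imsetP/idP => [[B]|eG]; first by rewrite inE => BG ->.
have eE : e = [set val x | x in [set x : {x | x \in A} | val x \in e]].
  apply/setP => v; apply/idP/imsetP => [ve|[x]]; last by rewrite inE => xe ->.
  by exists (exist _ v (subsetP (GA e eG) v ve)); rewrite ?inE.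
by exists [set x : {x | x \in A} | val x \in e]; rewrite // inE -eE.
Qed.

Section Weighted.
Variables (n s : nat) (H : {set {set 'I_n}}) (om : 'I_n -> rat).
Hypotheses (s0 : (0 < s)%N) (sn : (s < n)%N) (uH : uniform 4 H).
Hypothesis om01 : forall v, 0 <= om v <= 1.
Hypothesis om_mono : forall v v' : 'I_n, (v <= v')%N -> om v' <= om v.
Hypothesis om_cover : forall e, e \in H -> 1 <= \sum_(v in e) om v.

Let W : rat := \sum_(v in tail n s) om v.
Let A : rat := \sum_(v in initial n s) (1 - om v).
Let N := (n - s)%N.

Definition missing := (\sum_(i < s) #|ksubsets (tail n s) 3 :\: link H s i|)%N.

Let C : finType := {v : 'I_n | v \in tail n s}.
Let S : finType := {v : 'I_n | v \in initial n s}.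
Let X (c : C) := om (val c).
Let U (i : S) := 1 - om (val i).

Let cardC : #|C| = N.
Proof. by rewrite card_sig /N -card_tail; apply: eq_card => v; rewrite !inE. Qed.
Let cardS : #|S| = s.
Proof.
rewrite card_sig -[RHS]card_ord -sum1_card -[RHS]sum1_card.
rewrite [RHS](big_ord_widen n (fun _ => 1%N)) ?(ltnW sn) //.
by apply: eq_bigl => v; rewrite !inE.
Qed.

(** By monotonicity the weight of vertex [s - 1] bounds from below the weights of the first [s]
    vertices and from above all the others. *)
Let u : rat := 1 - om (Ordinal (leq_ltn_trans (leq_pred s) sn)).

Let sumX : \sum_c X c = W.
Proof. by rewrite /W [RHS]big_sub. Qed.
Let sumU : \sum_i U i = A.
Proof. by rewrite /A [RHS]big_sub. Qed.

Let C0 : (0 < #|C|)%N. Proof. by rewrite cardC subn_gt0. Qed.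
Let S0 : (0 < #|S|)%N. Proof. by rewrite cardS. Qed.
Let X0 c : 0 <= X c. Proof. by have /andP[] := om01 (val c). Qed.
Let U0 i : 0 <= U i. Proof. by have /andP[_] := om01 (val i); rewrite subr_ge0. Qed.
Let Xu c : X c <= 1 - u.
Proof.
rewrite /u opprB addrC subrK; apply: om_mono; have := valP c; rewrite inE /=.
exact: leq_trans (leq_pred s).
Qed.
Let Uu i : U i <= u.
Proof.
rewrite /U /u lerD2l lerN2; apply: om_mono; have := valP i; rewrite inE /=.
by move: (s0); lia.
Qed.

Let sum_val (t : seq C) : uniq t ->
  \sum_(v in [set val x | x in [set x in t]]) om v = \sum_(x <- t) X x.
Proof.
move=> ut; rewrite big_imset /=; last by move=> x y _ _; exact: val_inj.
by rewrite big_uniq //; apply: eq_bigl => x; rewrite inE.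
Qed.

Let heavy_inner : (24 * #|inner H s| <= #|heavy_quadruple X|)%N.
Proof.
rewrite -(@card_val_preimset _ (tail n s)); last by move=> e; rewrite inE => /andP[].
apply: quadruple_count.
  move=> B; rewrite !inE => /andP[BH _]; have := forall_inP uH _ BH.
  by rewrite card_imset; [move/eqP | exact: val_inj].
move=> x y z w; rewrite !inE => /andP[/om_cover + _] ut; rewrite sum_val //.
by rewrite !big_cons big_nil addr0 /heavy_quadruple /= !addrA.
Qed.

(** A light triple of distinct vertices, completed by its vertex [i], violates [om_cover] and so is
    missing from the link of [i]; degenerate triples cost [3 * N ^ 2] for each [i]. *)
Let light_missing : (#|light_quadruple X U| <= 6 * missing + 3 * s * N ^ 2)%N.
Proof.
pose P (i : S) : pred (C * C * C) := fun q => light_quadruple X U (q, i).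
have -> : #|light_quadruple X U| = (\sum_(i : S) #|P i|)%N.
  rewrite -sum1_card big_mkcond /=.
  rewrite -(pair_bigA _ (fun q i => if (q, i) \in light_quadruple X U then 1%N else 0%N)) /=.
  rewrite exchange_big /=; apply: eq_bigr => i _; rewrite -sum1_card [RHS]big_mkcond.
  by apply: eq_bigr.
have -> : missing = (\sum_(i : S) #|ksubsets (tail n s) 3 :\: link H s (val i)|)%N.
  rewrite /missing (big_ord_widen n (fun i => #|ksubsets (tail n s) 3 :\: link H s i|)) ?(ltnW sn) //.
  rewrite -(big_sub _ (fun v : 'I_n => #|ksubsets (tail n s) 3 :\: link H s v|)).
  by apply: eq_bigl => v; rewrite inE.
pose M (i : S) := #|ksubsets (tail n s) 3 :\: link H s (val i)|.
apply: (@leq_trans (\sum_(i : S) (6 * M i + 3 * N ^ 2))%N); last first.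
  by rewrite big_split /= -big_distrr /= sum_nat_const cardS mulnA [(s * 3)%N]mulnC.
apply: leq_sum => i _; rewrite -cardC /M.
rewrite -(@card_val_preimset _ (tail n s)); last by move=> e; rewrite !inE => /andP[_ /andP[]].
apply: triple_count.
  by move=> B; rewrite !inE => /andP[_ /andP[_]]; rewrite card_imset; [move/eqP | exact: val_inj].
move=> x y z ut; rewrite /P /light_quadruple /= => light.
rewrite inE; set T := [set val x | x in _].
have sT : T \subset tail n s by apply/subsetP => _ /imsetP[c _ ->]; exact: valP.
apply/setDP; split.
  rewrite inE sT card_imset; last exact: val_inj.
  by rewrite cardsE (card_uniqP ut).
rewrite inE; apply/negP => /andP[_]; rewrite adjoinE => /om_cover.
rewrite big_setU1 /=; last by apply: (@notin_tail _ s) => //; have := valP i; rewrite inE.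
rewrite sum_val // !big_cons big_nil addr0; move: light; rewrite /U /X; lra.
Qed.

Lemma weighted_counts : exists F : nat, [/\ (24 * #|inner H s| <= F)%N,
  F%:R <= 4 * N%:R ^+ 3 * W &
  0 < A -> 0 < W -> 4 * W * s%:R <= (1 + 1/10/10/10) * A * N%:R ->
  (1 + 2/10/10/10) * F%:R * A <= 4 * W * (6 * missing + 3 * s * N ^ 2)%:R].
Proof.
exists #|heavy_quadruple X|; split; first exact: heavy_inner.
  by have := heavy_count C0 S0 X0 Xu Uu; rewrite sumX cardC.
move=> A0 W0 hWA; have := heavy_light_count C0 S0 X0 Xu U0 Uu.
rewrite sumX sumU cardC cardS => /(_ A0 W0 hWA) h; apply: le_trans h _.
apply: ler_wpM2l; last by rewrite ler_nat; exact: light_missing.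
by apply: mulr_ge0; [exact: ler0n | exact: ltW].
Qed.

(** It identifies [W - A] with the excess of the cover's total weight over [s]. *)
Lemma weight_total : W - A + s%:R = \sum_v om v.
Proof.
have cI : #|initial n s| = s by rewrite -[RHS]cardS card_sig; apply: eq_card.
rewrite /A sumrB sumr_const cI opprB addrA subrK.
rewrite /W [RHS](bigID (mem (initial n s))) /= addrC; congr (_ + _).
by apply: eq_bigl => v; rewrite !inE -leqNgt.
Qed.

End Weighted.

(** Many missing sets make [F] of order [s ^+ 4], hence [W] of order [s], and the excess [d] is a
    tiny fraction of [W], so [A] is nearly at least [W]. With [4 * s <= N] the hypothesis of the
    last premise holds, and its conclusion gives [(1 + 1/1000) F <= 24 M + 12 s N^2]. Since
    [24 M <= F], this makes [F] at most of order [s ^+ 3]. *)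
Lemma weights_contradiction (R : realFieldType) (s N W A F M E d : R) :
  0 < s -> 4 * s <= N -> N <= 13 * s -> 12 * 13 * 13 * 2 * 10 * 10 * 10 < s ->
  W - A <= d -> d <= s / (8 * 13 * 13 * 13) / 2 / 10 / 10 / 10 ->
  s ^+ 4 <= 48 * M -> M <= E -> 24 * E <= F -> F <= 4 * N ^+ 3 * W ->
  (0 < A -> 0 < W -> 4 * W * s <= (1 + 1/10/10/10) * A * N ->
    (1 + 2/10/10/10) * F * A <= 4 * W * (6 * M + 3 * s * N ^+ 2)) -> False.
Proof.
move=> s0 N4 N13 sbig WA hd hM ME EF FW key.
have N0 : 0 < N by lra.
have F0 : s ^+ 4 / 2 <= F by lra.
have s40 : 0 < s ^+ 4 by rewrite exprn_gt0.
have N3 : N ^+ 3 <= (13 * s) ^+ 3 by rewrite lerXn2r // nnegrE; lra.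
have W0 : 0 < W.
  have : 0 < 4 * N ^+ 3 * W by lra.
  by rewrite pmulr_rgt0 // mulr_gt0 // exprn_gt0.
have Ws : s / (8 * 13 * 13 * 13) <= W.
  have h1 : 4 * N ^+ 3 * W <= 4 * (13 * s) ^+ 3 * W by rewrite ler_pM2r // ler_pM2l.
  have h2 : s ^+ 3 * (s / (8 * 13 * 13 * 13)) <= s ^+ 3 * W.
    rewrite (_ : s ^+ 3 * _ = s ^+ 4 / 2 / (4 * 13 ^+ 3)); last by field.
    rewrite ler_pdivrMr ?mulr_gt0 ?exprn_gt0 //.
    apply: le_trans F0 _; apply: le_trans FW _; apply: le_trans h1 _.
    by rewrite le_eqVlt; apply/orP; left; apply/eqP; ring.
  by rewrite ler_pM2l ?exprn_gt0 in h2.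
have dW : d <= W / 2 / 10 / 10 / 10 by lra.
have AW : (1 - 1/2/10/10/10) * W <= A by lra.
have A0 : 0 < A by lra.
have hAN : 4 * W * s <= (1 + 1/10/10/10) * A * N.
  have h1 : W <= (1 + 1/10/10/10) * A by lra.
  have h2 : W * (4 * s) <= (1 + 1/10/10/10) * A * N by apply: ler_pM => //; lra.
  by move: h2; rewrite mulrA [W * 4]mulrC.
have {}key := key A0 W0 hAN.
have F00 : 0 < F by apply: lt_le_trans F0; rewrite divr_gt0.
have h1 : (1 + 1/10/10/10) * F * W <= 4 * W * (6 * M + 3 * s * N ^+ 2).
  apply: le_trans key; rewrite -[leRHS]mulrA -mulrA [leRHS]mulrCA [leLHS]mulrCA ler_pM2l //.
  by lra.
have h2 : (1 + 1/10/10/10) * F <= 24 * M + 12 * s * N ^+ 2.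
  rewrite -(ler_pM2r W0); apply: le_trans h1 _.
  by rewrite le_eqVlt; apply/orP; left; apply/eqP; ring.
have h3 : F <= 10 * 10 * 10 * (12 * s * N ^+ 2) by lra.
have N2 : N ^+ 2 <= (13 * s) ^+ 2 by rewrite lerXn2r // nnegrE; lra.
have h4 : 12 * s * N ^+ 2 <= 12 * s * (13 * s) ^+ 2 by rewrite ler_pM2l //; lra.
have h5 : s ^+ 3 * s <= s ^+ 3 * (12 * 13 * 13 * 2 * 10 * 10 * 10).
  have -> : s ^+ 3 * s = s ^+ 4 by ring.
  have -> : s ^+ 3 * (12 * 13 * 13 * 2 * 10 * 10 * 10) = 2 * 10 * 10 * 10 * (12 * s * (13 * s) ^+ 2).
    by ring.
  by lra.
by rewrite ler_pM2l ?exprn_gt0 // leNgt sbig in h5.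
Qed.

Lemma inner_le_missing n s B L (H : {set {set 'I_n}}) :
  shifted H -> uniform 4 H -> (matching_number H <= s)%N ->
  (0 < s)%N -> (5 * s <= n)%N -> (n - s <= 13 * s)%N ->
  (0 < L)%N -> (B.+1 * L <= n)%N -> (n < B.+2 * L)%N ->
  12 * 13 * 13 * 2 * 10 * 10 * 10 < s%:R :> rat ->
  (1 + B.+1 ^ 4 + L)%:R <= s%:R / (8 * 13 * 13 * 13) / 2 / 10 / 10 / 10 :> rat ->
  (s ^ 4 <= 48 * missing s H)%N ->
  (#|inner H s| <= missing s H)%N.
Proof.
move=> sH uH nuH s0 sn5 n14 L0 BLn nBL sbig hd hM.
have sn : (s < n)%N by lia.
have [om [om01 om_mono om_tot om_cover]] := fractional_cover L0 BLn nBL sH uH nuH.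
have [F [EF FW key]] := weighted_counts s0 sn uH om01 om_mono om_cover.
have WA := weight_total om sn.
rewrite leqNgt; apply/negP => /ltnW ME.
apply: (@weights_contradiction rat s%:R (n - s)%:R (\sum_(v in tail n s) om v)
  (\sum_(v in initial n s) (1 - om v)) F%:R (missing s H)%:R
  #|inner H s|%:R (1 + B.+1 ^ 4 + L)%:R _ _ _ sbig _ hd _ _ _ FW).
- by rewrite ltr0n.
- rewrite -natrM ler_nat; move: sn5; clear; lia.
- by rewrite -natrM ler_nat; exact: n14.
- rewrite -(lerD2r s%:R) WA; apply: le_trans om_tot _; rewrite -natrD ler_nat.
  by move: (B.+1 ^ 4)%N; clear; lia.
- by rewrite -natrX -natrM ler_nat; exact: hM.
- by rewrite ler_nat; exact: ME.
- by rewrite -natrM ler_nat; exact: EF.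
- move=> A0 W0 hWA; apply: le_trans (key A0 W0 hWA) _.
  by rewrite natrD [X in _ + X]natrM natrX !natrM; exact: lexx.
Qed.

(** * Assembling the cases *)

Local Open Scope nat_scope.

(** By nestedness every link from [j.-1] to [s.-1] misses at least the triples missing from that of
    [j.-1]; passing to the larger [tail n s] only adds missing ones. *)
Lemma missing_ge n s j c (H : {set {set 'I_n}}) :
  shifted H -> s < n -> 0 < j -> j <= s ->
  c <= #|ksubsets (tail n s.+1) 3 :\: link H s.+1 j.-1| ->
  (s - j.-1) * c <= missing s H.
Proof.
move=> sH sn j0 js hc.
rewrite /missing -(big_mkord xpredT (fun i => #|ksubsets (tail n s) 3 :\: link H s i|)).
rewrite (big_cat_nat (n := j.-1)) //=; last by lia.
apply: leq_trans (leq_addl _ _); rewrite -sum_nat_const_nat.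
rewrite big_nat_cond [leqRHS]big_nat_cond; apply: leq_sum => i /andP[/andP[ji is_] _].
apply: leq_trans hc _; apply: subset_leq_card; apply/subsetP => T; rewrite !inE.
move=> /andP[nT /andP[sT cT]]; rewrite cT andbT.
have sT' : T \subset tail n s.
  by apply: subset_trans sT _; apply/subsetP => v; rewrite !inE => /ltnW.
rewrite sT' andbT; apply: contraNN nT => /andP[_ TH].
have : T \in link H s.+1 i by rewrite !inE sT cT.
move/(subsetP (@link_nested n H s.+1 j.-1 i sH sn ji _)).
by rewrite !inE; apply; lia.
Qed.

Lemma bound_from_missing n s (H : {set {set 'I_n}}) :
  uniform 4 H -> s <= n -> #|inner H s| <= missing s H ->
  #|H| <= 'C(n, 4) - 'C(n - s, 4).
Proof.
move=> uH sn hM; have := edge_count sn uH.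
have : \sum_(i < s) #|link H s i| + missing s H = s * 'C(n - s, 3).
  transitivity (\sum_(i < s) 'C(n - s, 3)); last by rewrite sum_nat_const card_ord.
  rewrite -big_split /=; apply: eq_bigr => i _.
  by rewrite -card_tail -card_ksubsets -[RHS](cardsID (link H s i)) (setIidPr (link_sub _ _ _)).
rewrite leq_subRL; last by apply: leq_bin2l; exact: leq_subr.
by move: hM; lia.
Qed.

Lemma quartic_le s j c : 16 <= s -> j = (8 * s + 24) %/ 12 -> 'C(s.-1, 3) <= c ->
  s ^ 4 <= 48 * ((s - j.-1) * c).
Proof.
move=> s16 jE hc.
have h1 : s <= 4 * (s - j.-1) by lia.
have h2 : s ^ 3 <= 12 * 'C(s.-1, 3).
  have -> : 12 * 'C(s.-1, 3) = 2 * (s.-1 ^_ 3).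
    by rewrite -bin_ffact (_ : 3`! = 6) // [in RHS]mulnCA mulnC.
  have [t ->] : exists t, s = t + 16 by exists (s - 16); lia.
  have -> : (t + 16).-1 = t + 15 by lia.
  rewrite !ffactnS ffactn0.
  have -> : (t + 15).-1 = t + 14 by lia.
  have -> : (t + 14).-1 = t + 13 by lia.
  by rewrite expnS -mulnn; nia.
have h3 : s ^ 3 <= 12 * c by apply: leq_trans h2 _; rewrite leq_mul2l hc orbT.
have -> : 48 * ((s - j.-1) * c) = (4 * (s - j.-1)) * (12 * c) by lia.
by rewrite expnS; apply: leq_mul.
Qed.

Lemma rat_lt_nat (x : rat) : exists k : nat, (x < k%:R)%R.
Proof.
exists (Num.bound `|x|); apply: le_lt_trans (ler_norm x) _.
by apply: archi_boundP; exact: normr_ge0.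
Qed.

(* The number of blocks is fixed before [s], which makes the excess weight of the
   fractional cover at most [theta s]. *)
Lemma shifted_bound_large : exists s0, forall n s (H : {set {set 'I_n}}),
  s0 <= s -> 5 * s <= n -> n < 13 * s + 13 ->
  shifted H -> uniform 4 H -> matching_number H <= s ->
  #|H| <= 'C(n, 4) - 'C(n - s, 4).
Proof.
have [theta theta0 thetaE] : exists2 theta : rat, (0 < theta)%R &
    forall x, (x / (8 * 13 * 13 * 13) / 2 / 10 / 10 / 10 = theta * x)%R.
  exists (1 / (8 * 13 * 13 * 13) / 2 / 10 / 10 / 10)%R; first lra.
  by move=> x; lra.
(* From [B.+1 * L <= n <= 14 * s], the constant 28 makes [L] at most half of [theta * s]; the other
   half is for [1 + B.+1 ^ 4]. *)
have [B hB] : exists B : nat, (28 < theta * B.+1%:R)%R.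
  have [B hB] := rat_lt_nat (28 / theta); exists B.
  rewrite [ltRHS]mulrC -ltr_pdivrMr; last exact: theta0.
  apply: lt_le_trans hB _.
  by rewrite ler_nat; exact: leqnSn.
have [k1 hk1] := rat_lt_nat (12 * 13 * 13 * 2 * 10 * 10 * 10).
have [k2 hk2] : exists k2 : nat, ((1 + B.+1 ^ 4)%:R * 2 < theta * k2%:R)%R.
  have [k2 hk2] := rat_lt_nat ((1 + B.+1 ^ 4)%:R * 2 / theta); exists k2.
  by rewrite [ltRHS]mulrC -ltr_pdivrMr.
exists (k1 + k2 + B.+1 * B.+1 + 16) => n s H hs n5 n13 sH uH nuH.
have s0 : 0 < s by lia.
have sn : s < n by lia.
have s16 : 16 <= s by lia.
(* The least [j] with [8 * s + 13 <= 12 * j], which is what [near_extremal_bound] asks for when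
   [n = 5 * s]. *)
pose j := (8 * s + 24) %/ 12.
have j0 : 0 < j by rewrite /j; lia.
have js : j <= s by rewrite /j; lia.
have [sparse|dense] := leqP 'C(n - s.+1 - 3 * s, 3)
    #|ksubsets (tail n s.+1) 3 :\: link H s.+1 j.-1|; last first.
  apply: (near_extremal_bound sH uH nuH sn js _ (fun _ => dense)).
  by move: n5 s16; rewrite /j; clear; lia.
have hM := missing_ge sH sn j0 js (leqnn _).
apply: (bound_from_missing uH (ltnW sn)).
pose L := n %/ B.+1.
(* Then the remainder of [n] modulo [B.+1] is shorter than one block. *)
have BL : B.+1 <= L by rewrite leq_divRL; lia.
have L0 : 0 < L by lia.
have BLn : B.+1 * L <= n by rewrite mulnC; exact: leq_trunc_div.
have nBL : n < B.+2 * L.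
  rewrite [X in X < _](divn_eq n B.+1) -/L mulSn [L + _]addnC [B.+1 * L]mulnC ltn_add2l.
  by apply: leq_trans BL; exact: ltn_pmod.
have le_s k : k <= s -> (k%:R <= s%:R :> rat)%R by rewrite ler_nat.
apply: (inner_le_missing sH uH nuH s0 n5 _ L0 BLn nBL).
- by move: n13 s16; clear; lia.
- by apply: lt_le_trans hk1 _; apply: le_s; move: hs; clear; lia.
- rewrite thetaE natrD.
  have h2 : ((1 + B.+1 ^ 4)%:R * 2 <= theta * s%:R :> rat)%R.
    apply: le_trans (ltW hk2) _; rewrite ler_pM2l; last exact: theta0.
    by apply: le_s; move: hs; clear; lia.
  have h3 : (L%:R * 2 <= theta * s%:R :> rat)%R.
    have B0 : (0 < B.+1%:R :> rat)%R by rewrite ltr0n.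
    have h4 : (B.+1%:R * L%:R <= 14 * s%:R :> rat)%R.
      by rewrite -!natrM ler_nat; apply: leq_trans BLn _; move: n13 s16; clear; lia.
    have h5 : (28 * s%:R <= theta * B.+1%:R * s%:R :> rat)%R.
      apply: ler_wpM2r; [exact: ler0n | exact: ltW].
    have : (B.+1%:R * (L%:R * 2) <= B.+1%:R * (theta * s%:R) :> rat)%R.
      by move: h4 h5; clear; lra.
    by rewrite ler_pM2l.
  by move: h2 h3; clear; lra.
- apply: leq_trans (leq_mul (leqnn 48) hM); apply: (quartic_le s16 (erefl _)).
  by apply: leq_trans sparse; apply: leq_bin2l; move: n5; clear; lia.
Qed.

Theorem theorem1p1 :
  exists n0 : nat,
    forall (n s : nat) (T : finType) (H : {set {set T}}),
      0 < n -> 0 < s -> 5 * s <= n -> n0 <= n ->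
      #|T| = n -> uniform 4 H -> matching_number H <= s ->
      #|H| <= 'C(n, 4) - 'C(n - s, 4).
Proof.
have [s0 large] := shifted_bound_large.
(* If [n < 13 * s + 13], this forces [s0 <= s]; otherwise [near_extremal_bound] applies with
   [j = 0], without any greedy step. *)
exists (13 * s0 + 13) => n s T H n0 sp n5 nbig cT uH nuH.
have [H1 [uH1 nuH1 <-]] := transport_hypergraph (@enum_rank_bij T) uH nuH.
have [H2 [sH2 uH2 nuH2 <-]] := shifted_exists uH1 nuH1.
move: H2 sH2 uH2 nuH2; rewrite cT => H2 sH2 uH2 nuH2.
have [n13|n13] := ltnP n (13 * s + 13).
  by apply: (large n s H2 _ n5 n13 sH2 uH2 nuH2); lia.
apply: (@near_extremal_bound n s 0 H2 sH2 uH2 nuH2 _ (leq0n s)); [lia | lia | by []].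
Qed.
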